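(* Let $(X_j)_{j\ge1}$ be a sequence of real random variables with finite third absolute moments which are conditionally independent given a latent random variable $Z$. For $n\ge 1$ put $$\sigma_{j,Z}^2=\operatorname{var}(X_j\mid Z),\qquad s_{n,Z}^2=\sum_{j=1}^n\sigma_{j,Z}^2,\qquad \bar X_n=\frac1{s_{n,Z}}\sum_{j=1}^n\big(X_j-\mathbb{E}[X_j\mid Z]\big),$$ and suppose $s_{n,Z}>0$ almost surely. Then $$d_W(\bar X_n,\mathcal{N}(0,1))\le 2(\sqrt2+1)\,\mathbb{E}\left[\frac1{s_{n,Z}^3}\sum_{i=1}^n\big|X_i-\mathbb{E}[X_i\mid Z]\big|^3\right].$$
   Context: $Z$ takes values in a Polish space. Conditional independence given $Z$ means that, for each $j$, the conditional law of $X_j$ given $\sigma((X_i)_{i\neq j},Z)$ equals its conditional law given $\sigma(Z)$. $\mathcal{N}(0,1)$ is the standard normal law, and $d_W(F,\mathcal{N}(0,1))=\sup_h|\mathbb{E}[h(F)]-\mathbb{E}[h(Y)]|$, with $Y\sim\mathcal{N}(0,1)$ and the supremum over $1$-Lipschitz $h:\mathbb{R}\to\mathbb{R}$. *)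

(* Defs.v *)
From HB Require Import structures.
From mathcomp Require Import all_boot all_order all_algebra.
From mathcomp Require Import all_classical all_reals all_analysis.

Set Implicit Arguments.
Unset Strict Implicit.
Unset Printing Implicit Defensive.

Import Order.TTheory GRing.Theory Num.Theory.
Import numFieldNormedType.Exports.

Local Open Scope classical_set_scope.
Local Open Scope ring_scope.
Local Open Scope ereal_scope.

Definition polish_space (R : realType) (E : topologicalType) : Prop :=
  (exists2 D : set E, countable D & dense D) /\
  exists d : E -> E -> R,
    [/\ forall x y, (d x y = 0)%R <-> x = y,
        forall x y, d x y = d y x,
        forall x y z, (d x z <= d x y + d y z)%R,
        (forall x (A : set E), nbhs x A <->
           exists2 e : R, (0 < e)%R & [set y | (d x y < e)%R] `<=` A) &
        forall u : nat -> E,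
          (forall e : R, (0 < e)%R -> exists N : nat, forall m n : nat,
             (N <= m)%N -> (N <= n)%N -> (d (u m) (u n) < e)%R) ->
          exists l : E, u @ \oo --> l].

Definition borel (E : topologicalType) : set_system E := <<s @open E >>.

Definition sigma_of (T E : Type) (EE : set_system E) (Z : T -> E)
  : set_system T := preimage_set_system setT Z EE.

Section Conditioning.
Context (d : measure_display) (T : measurableType d) (R : realType).
Variable P : probability T R.

(* [Y] is a version of E[X | G], for [G] a sub-sigma-algebra given as a set
   system; the predicate is false when [X] is not integrable. *)
Definition is_cond_exp (G : set_system T) (X Y : T -> R) : Prop :=
  [/\ P.-integrable setT (EFin \o X),
      P.-integrable setT (EFin \o Y),
      forall B : set R, measurable B -> G (Y @^-1` B) &
      forall A, G A -> \int[P]_(w in A) (Y w)%:E = \int[P]_(w in A) (X w)%:E].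

Definition is_cond_var (G : set_system T) (X V : T -> R) : Prop :=
  exists2 M : T -> R, is_cond_exp G X M &
    is_cond_exp G (fun w => (X w - M w) ^+ 2)%R V.

(* [k] is a regular conditional distribution of [X] given [G]. *)
Definition is_cond_law (G : set_system T) (X : T -> R)
    (k : T -> probability (measurableTypeR R) R) : Prop :=
  forall B : set R, measurable B ->
    is_cond_exp G (\1_(X @^-1` B)) (fun w => fine (k w B)).

(* Regular conditional distributions of a real random variable always exist
   and are almost surely unique, so the existential quantifiers below only
   name "the" two conditional laws. *)
Definition same_cond_law (G H : set_system T) (X : T -> R) : Prop :=
  exists k l : T -> probability (measurableTypeR R) R,
    [/\ is_cond_law G X k, is_cond_law H X l &
        {ae P, forall w, forall B : set R, measurable B -> k w B = l w B}].

Definition cond_independent (E : topologicalType) (Z : T -> E)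
    (X : nat -> T -> R) : Prop :=
  forall j : nat,
    same_cond_law
      <<s (\bigcup_(i in [set i | i <> j]) sigma_of measurable (X i))
          `|` sigma_of (@borel E) Z >>
      (sigma_of (@borel E) Z) (X j).

Definition wasserstein (F : T -> R) (nu : probability (measurableTypeR R) R)
  : \bar R :=
  ereal_sup [set `|'E_P[h \o F] - 'E_nu[h]| |
    h in [set h : R -> R | (1 : R).-lipschitz h]].

End Conditioning.

Section NormalizedSum.
Context (T : Type) (R : realType).

Definition cond_std (V : nat -> T -> R) (n : nat) (w : T) : R :=
  Num.sqrt (\sum_(j < n) V j w).

Definition normalized_sum (X M V : nat -> T -> R) (n : nat) (w : T) : R :=
  ((cond_std V n w)^-1 * \sum_(j < n) (X j w - M j w))%R.

End NormalizedSum.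

(* Main.v *)
Require Import Defs.
From HB Require Import structures.
From mathcomp Require Import all_boot all_order all_algebra.
From mathcomp Require Import all_classical all_reals all_analysis.
From mathcomp Require Import measurable_realfun ring lra.

(** Stein's method, carried out on unconditional integrals: the conditioning
    on Z enters only through products with functions of Z and of the other
    variables, so no disintegration is needed.

    Analytic half. For a 1-Lipschitz h with Gaussian mean m, the equation
    f'(x) - x f(x) = h(x) - m is solved by f = F / phi, where phi is the normal
    density and F(x) is the integral of (h - m) phi over ]-oo, x]. What is
    needed is that f' is 2-Lipschitz [stein_der_lip]. Since f' = h - m + g with
    g(x) = x f(x), it suffices that |g'| <= 1. For fixed x,
    phi(x) g'(x) = A I - B J, where I and J are the integrals of (h - h(x)) phi
    to the left and to the right of x, and where A and B do not depend on h and
    are nonnegative by Mills' inequality [mills]. Hence the extremal h are the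
    linear ones, for which f is constant and g' = 1 or -1. As g(0) = 0, the same
    estimate bounds f.

    Probabilistic half. Put xi_i = (X_i - E[X_i | Z]) / s, v_i = var(X_i | Z) / s^2,
    W = sum xi_i and W_i = W - xi_i. Conditional independence makes xi_i and
    xi_i^2 - v_i integrate to zero against functions of Z and the X_j, j <> i
    [cond_exp_orthogonal, cond_var_orthogonal], such as f(W_i) and f'(W_i).
    Because the v_i sum to 1, the quantity h(W) - m = f'(W) - W f(W) is, up to
    such mean-zero terms,
      sum v_i (f'(W) - f'(W_i)) - sum xi_i (f(W) - f(W_i) - xi_i f'(W_i)),
    which is at most sum (2 v_i |xi_i| + 2 |xi_i|^3). Finally
    v_i |xi_i| <= |xi_i|^3 - sqrt(v_i) (xi_i^2 - v_i) [cube_tangent], and the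
    correction has mean zero as well. The total is 4 sum E|xi_i|^3
    [stein_bound], and 4 <= 2 (sqrt 2 + 1). When the right-hand side is infinite
    there is nothing to prove; otherwise the third moments of the xi_i provide
    every integrability that is used.

    The hypothesis on conditional laws is turned into orthogonality in
    [cond_law_integral_eq]: if A is an event of sigma((X_j), j <> i, Z), then
    P(A | Z) is also a version of P(A | X_i, Z), so that integrating a function
    of (X_i, Z) over A amounts to integrating it against the weight P(A | Z),
    and this weight depends on Z only. *)

Set Implicit Arguments.
Unset Strict Implicit.
Unset Printing Implicit Defensive.

Import Order.TTheory GRing.Theory Num.Theory.
Import numFieldNormedType.Exports.

Local Open Scope classical_set_scope.
Local Open Scope ring_scope.
Local Open Scope ereal_scope.

Import HBNNSimple.

(** * Weighted integrals and taking out what is known *)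

Section weighted.
Context {R : realType} {d d' : measure_display}.
Context {T : measurableType d} {S : measurableType d'}.
Implicit Types (mu nu : {measure set T -> \bar R}) (p : T -> S).

Lemma ge0_integral_weight_nnsfun mu p (u : T -> R) (f : {nnsfun S >-> R}) :
  measurable_fun setT p -> measurable_fun setT u -> (forall x, 0 <= u x)%R ->
  \int[mu]_x (f (p x) * u x)%:E =
  \sum_(y \in range f) y%:E * \int[mu]_(x in p @^-1` (f @^-1` [set y])) (u x)%:E.
Proof.
move=> mp mu_ u0.
have mpf y : measurable (p @^-1` (f @^-1` [set y])).
  by rewrite -[X in measurable X]setTI; exact: mp.
have mi y : measurable_fun setT (fun x => \1_(f @^-1` [set y]) (p x) : R).
  by apply: measurableT_comp => //.
have i0 y x : (0 <= \1_(f @^-1` [set y]) (p x) * u x :> R)%R.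
  by rewrite mulr_ge0.
transitivity (\int[mu]_x (\sum_(y \in range f)
   (y * (\1_(f @^-1` [set y]) (p x) * u x))%:E)).
  apply: eq_integral => x _; rewrite (fimfunE f (p x)) fsumEFin//.
  by rewrite mulr_fsuml; congr EFin; apply: eq_fsbigr => y _; rewrite mulrA.
rewrite ge0_integral_fsum//=; last 2 first.
- move=> y; apply/measurable_EFinP; apply: measurable_funM => //.
  exact: measurable_funM.
- move=> y x _; rewrite lee_fin.
  have [[z _ <-]|yf] := pselect (range f y); first by rewrite mulr_ge0.
  rewrite indicE memNset ?mul0r ?mulr0//= => pxy; apply: yf; by exists (p x).
apply: eq_fsbigr => y; rewrite inE => -[z _ <-].
under eq_integral do rewrite EFinM.
rewrite ge0_integralZl//; last 3 first.
- by apply/measurable_EFinP; exact: measurable_funM.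
- by move=> x _; rewrite lee_fin.
- by rewrite lee_fin.
congr (_ * _); rewrite [RHS]integral_mkcond; apply: eq_integral => x _.
rewrite patchE indicE.
have -> : (x \in p @^-1` (f @^-1` [set f z])) = (p x \in f @^-1` [set f z]).
  by apply/idP/idP; rewrite !inE.
by case: ifP => _; rewrite ?mul1r ?mul0r.
Qed.

(** Weights that agree on average over every event pulled back along [p] cannot
    be told apart by functions of [p]. With [p] the identity this is the
    change-of-density formula; with [p] the identity onto a smaller
    sigma-algebra it is the rule for taking out what is known. *)
Lemma ge0_integral_weight_eq mu nu p (u v : T -> R) (f : S -> R) :
  measurable_fun setT p -> measurable_fun setT u -> measurable_fun setT v ->
  (forall x, 0 <= u x)%R -> (forall x, 0 <= v x)%R ->
  (forall A, measurable A -> \int[mu]_(x in p @^-1` A) (u x)%:E =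
                             \int[nu]_(x in p @^-1` A) (v x)%:E) ->
  measurable_fun setT f -> (forall y, 0 <= f y)%R ->
  \int[mu]_x (f (p x) * u x)%:E = \int[nu]_x (f (p x) * v x)%:E.
Proof.
move=> mp mu_ mv u0 v0 uv mf f0.
have mfE : measurable_fun setT (EFin \o f) by exact/measurable_EFinP.
pose h := nnsfun_approx measurableT mfE.
have lim_h (m : {measure set T -> \bar R}) (w : T -> R) :
    measurable_fun setT w -> (forall x, 0 <= w x)%R ->
    \int[m]_x (f (p x) * w x)%:E = lim (\int[m]_x (h n (p x) * w x)%:E @[n --> \oo]).
  move=> mw w0.
  have fw x : (f (p x) * w x)%:E = lim ((h n (p x) * w x)%:E @[n --> \oo]).
    apply/esym/cvg_lim => //; rewrite EFinM; under eq_fun do rewrite EFinM.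
    apply: cvgeZr => //.
    have fE0 y : [set: S] y -> 0 <= (EFin \o f) y by move=> _; rewrite lee_fin.
    exact: (@cvg_nnsfun_approx _ _ _ _ measurableT _ mfE fE0 (p x)).
  under eq_integral => x _ do rewrite fw.
  apply: monotone_convergence => //.
  - move=> n; apply/measurable_EFinP/measurable_funM => //.
    exact: measurableT_comp.
  - by move=> n x _; rewrite lee_fin mulr_ge0.
  - move=> x _ a b ab; rewrite lee_fin ler_wpM2r//.
    exact/lefP/nd_nnsfun_approx.
rewrite !lim_h//; suff E n : \int[mu]_x (h n (p x) * u x)%:E =
    \int[nu]_x (h n (p x) * v x)%:E by under eq_fun do rewrite E.
rewrite !ge0_integral_weight_nnsfun//; apply: eq_fsbigr => y _.
by rewrite uv.
Qed.

Lemma integral_weight_eq mu nu p (u v : T -> R) (f : S -> R) :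
  measurable_fun setT p -> measurable_fun setT u -> measurable_fun setT v ->
  (forall x, 0 <= u x)%R -> (forall x, 0 <= v x)%R ->
  (forall A, measurable A -> \int[mu]_(x in p @^-1` A) (u x)%:E =
                             \int[nu]_(x in p @^-1` A) (v x)%:E) ->
  measurable_fun setT f ->
  mu.-integrable setT (fun x => (f (p x) * u x)%:E) ->
  nu.-integrable setT (fun x => (f (p x) * v x)%:E) /\
  \int[mu]_x (f (p x) * u x)%:E = \int[nu]_x (f (p x) * v x)%:E.
Proof.
move=> mp mu_ mv u0 v0 uv mf ifu.
have mfv : measurable_fun setT (fun x => (f (p x) * v x)%:E).
  by apply/measurable_EFinP/measurable_funM => //; exact: measurableT_comp.
have take (g : S -> R) : measurable_fun setT g -> (forall x, 0 <= g x)%R ->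
    \int[mu]_x (g (p x) * u x)%:E = \int[nu]_x (g (p x) * v x)%:E.
  by move=> mg g0; exact: ge0_integral_weight_eq.
have ifv : nu.-integrable setT (fun x => (f (p x) * v x)%:E).
  apply/integrableP; split => //.
  move/integrableP : ifu => [_].
  under eq_integral do rewrite /= normrM (ger0_norm (u0 _)).
  under [in X in _ -> X]eq_integral do rewrite /= normrM (ger0_norm (v0 _)).
  by rewrite (take (fun y => `|f y|%R))//; exact: measurableT_comp.
split => //.
have pos (w : T -> R) x : (0 <= w x)%R ->
    (fun x => (f (p x) * w x)%:E)^\+ x = (Num.max (f (p x)) 0 * w x)%:E.
  by move=> w0; rewrite funeposE -EFin_max maxr_pMl// mul0r.
have neg (w : T -> R) x : (0 <= w x)%R ->
    (fun x => (f (p x) * w x)%:E)^\- x = (Num.max (- f (p x)) 0 * w x)%:E.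
  by move=> w0; rewrite funenegE -EFinN -EFin_max maxr_pMl// mul0r mulNr.
rewrite [LHS]integralE [RHS]integralE.
under eq_integral do rewrite pos//.
under [X in _ - X]eq_integral do rewrite neg//.
under [in RHS]eq_integral do rewrite pos//.
under [X in _ = _ - X]eq_integral do rewrite neg//.
rewrite (take (fun y => Num.max (f y) 0)%R)//; last 2 first.
- exact: measurable_maxr.
- by move=> x; rewrite le_max lexx orbT.
rewrite (take (fun y => Num.max (- f y) 0)%R)//.
- by apply: measurable_maxr => //; exact: measurable_funN.
- by move=> x; rewrite le_max lexx orbT.
Qed.

End weighted.

Section conditional_probability.
Context {R : realType} {d d' : measure_display}.
Context {T : measurableType d} {S : measurableType d'}.
Variables (P : probability T R) (p : {mfun T >-> S}).
Variables (A : set T) (mA : measurable A).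

Let nu : set S -> \bar R := pushforward (mrestr P mA) p.

Let nu0 : nu set0 = 0. Proof. exact: measure0. Qed.

Let nu_ge0 B : 0 <= nu B. Proof. exact: measure_ge0. Qed.

Let nu_additive : semi_sigma_additive nu.
Proof. exact: measure_semi_sigma_additive. Qed.

HB.instance Definition _ := isMeasure.Build _ _ _ nu nu0 nu_ge0 nu_additive.

Let nu_fin : fin_num_fun nu.
Proof.
move=> B mB; rewrite /nu /pushforward /mrestr fin_num_measure//.
by apply: measurableI => //; rewrite -[X in measurable X]setTI; exact: measurable_funPT.
Qed.

HB.instance Definition _ := @Measure_isFinite.Build _ _ _ nu nu_fin.

(** The Radon-Nikodym density, with respect to the law of [p], of the image under
    [p] of the restriction of P to A. *)
Lemma ex_cond_prob : exists a : S -> R,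
  [/\ measurable_fun setT a, forall y, (0 <= a y)%R,
      P.-integrable setT (EFin \o (a \o p)) &
      forall B, measurable B ->
        \int[P]_(x in p @^-1` B) (a (p x))%:E = P (A `&` p @^-1` B)].
Proof.
have mp : measurable_fun setT p by [].
have nuP : nu `<< distribution P p.
  apply/null_content_dominatesP => B mB.
  have mpB : measurable (p @^-1` B).
    by rewrite -[X in measurable X]setTI; exact: mp.
  rewrite /distribution /nu /pushforward /mrestr /= => PB0.
  apply/eqP; rewrite -measure_le0 -PB0 le_measure ?inE//.
  exact: measurableI.
have [a [a0 afin ia aE]] := radon_nikodym_sigma_finite nuP.
have aB B : measurable B ->
    \int[P]_(x in p @^-1` B) (fine (a (p x)))%:E = P (A `&` p @^-1` B).
  move=> mB; rewrite setIC -[RHS]/(nu B) aE// ge0_integral_pushforward//=.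
    by apply: eq_integral => x _; rewrite fineK.
  by apply: (measurable_funS measurableT) => //; exact: measurable_int ia.
exists (fine \o a); split => //.
- by apply: measurableT_comp => //; exact: measurable_int ia.
- by move=> y; rewrite fine_ge0.
- apply/integrableP; split.
    apply/measurable_EFinP; apply: measurableT_comp => //.
    by apply: measurableT_comp => //; exact: measurable_int ia.
  rewrite (eq_integral (fun x => (fine (a (p x)))%:E)); last first.
    by move=> x _; rewrite /= ger0_norm// fine_ge0.
  rewrite -(preimage_setT p) aB// preimage_setT setIT.
  by rewrite (le_lt_trans (probability_le1 _ _)) ?ltry.
Qed.

End conditional_probability.

(** A sub-sigma-algebra is handled as the measurable type it generates on the
    same carrier, which makes the whole calculus of measurable functions
    available for it. *)
Section sub_sigma_algebra.
Context {R : realType} {d : measure_display} {T : measurableType d}.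

Definition measurable_wrt (G : set_system T) (f : T -> R) :=
  forall B : set R, measurable B -> G (f @^-1` B).

Definition sigma_subalgebra (G : set_system T) :=
  sigma_algebra setT G /\ G `<=` measurable.

Variables (P : probability T R) (G : set_system T).
Hypothesis sG : sigma_subalgebra G.

Lemma sub_sigma_measurableE : G.-sigma.-measurable = G.
Proof. by apply: measurable_g_measurableTypeE; case: sG. Qed.

Lemma measurable_wrtP (f : T -> R) :
  measurable_wrt G f <-> measurable_fun setT (f : g_sigma_algebraType G -> R).
Proof.
split=> [mf _ B mB|mf B mB].
  by rewrite setTI sub_sigma_measurableE; exact: mf.
have := mf measurableT B mB; rewrite setTI.
by move=> h; rewrite -sub_sigma_measurableE.
Qed.

Lemma measurable_id_sub : measurable_fun setT (id : T -> g_sigma_algebraType G).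
Proof.
move=> _ B mB; rewrite setTI.
by apply: sG.2; rewrite -sub_sigma_measurableE.
Qed.

Lemma measurable_wrt_measurable (f : T -> R) :
  measurable_wrt G f -> measurable_fun setT f.
Proof. by move=> mf _ B mB; rewrite setTI; exact/sG.2/mf. Qed.

Lemma ge0_integral_take_out (u v f : T -> R) :
  measurable_fun setT u -> measurable_fun setT v ->
  (forall x, 0 <= u x)%R -> (forall x, 0 <= v x)%R ->
  (forall A, G A -> \int[P]_(x in A) (u x)%:E = \int[P]_(x in A) (v x)%:E) ->
  measurable_wrt G f -> (forall x, 0 <= f x)%R ->
  \int[P]_x (f x * u x)%:E = \int[P]_x (f x * v x)%:E.
Proof.
move=> mu_ mv u0 v0 uv mf f0.
apply: (@ge0_integral_weight_eq _ _ _ _ (g_sigma_algebraType G) P P id) => //.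
- exact: measurable_id_sub.
- by move=> A; rewrite sub_sigma_measurableE preimage_id; exact: uv.
- exact/measurable_wrtP.
Qed.

Lemma integral_take_out (u v f : T -> R) :
  measurable_fun setT u -> measurable_fun setT v ->
  (forall x, 0 <= u x)%R -> (forall x, 0 <= v x)%R ->
  (forall A, G A -> \int[P]_(x in A) (u x)%:E = \int[P]_(x in A) (v x)%:E) ->
  measurable_wrt G f ->
  P.-integrable setT (fun x => (f x * u x)%:E) ->
  P.-integrable setT (fun x => (f x * v x)%:E) /\
  \int[P]_x (f x * u x)%:E = \int[P]_x (f x * v x)%:E.
Proof.
move=> mu_ mv u0 v0 uv mf.
apply: (@integral_weight_eq _ _ _ _ (g_sigma_algebraType G) P P id) => //.
- exact: measurable_id_sub.
- by move=> A; rewrite sub_sigma_measurableE preimage_id; exact: uv.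
- exact/measurable_wrtP.
Qed.

End sub_sigma_algebra.

(** * Conditional independence *)

Section pi_lambda.
Context {R : realType} {d : measure_display} {T : measurableType d}.
Variable (P : probability T R).

Lemma integral_pi_lambda (C : set_system T) (u v : T -> R) :
  setI_closed C -> C setT -> C `<=` measurable ->
  P.-integrable setT (EFin \o u) -> P.-integrable setT (EFin \o v) ->
  (forall x, 0 <= u x)%R -> (forall x, 0 <= v x)%R ->
  (forall A, C A -> \int[P]_(x in A) (u x)%:E = \int[P]_(x in A) (v x)%:E) ->
  forall A, <<s C >> A ->
  \int[P]_(x in A) (u x)%:E = \int[P]_(x in A) (v x)%:E.
Proof.
move=> CI CT Cm iu iv u0 v0 uv.
pose D := [set A | measurable A /\
  \int[P]_(x in A) (u x)%:E = \int[P]_(x in A) (v x)%:E].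
suff DC : <<s C >> `<=` D by move=> A /DC[].
apply: lambda_system_subset => //; last by move=> A CA; split; [exact: Cm|exact: uv].
split=> //.
- by split=> //; exact: uv.
- move=> A B BA [mA eA] [mB eB]; split; first exact: measurableD.
  have cut w : P.-integrable setT (EFin \o w) -> (forall x, 0 <= w x)%R ->
      \int[P]_(x in A `\` B) (w x)%:E =
      \int[P]_(x in A) (w x)%:E - \int[P]_(x in B) (w x)%:E.
    move=> iw w0; have mw := measurable_int _ iw.
    have -> : \int[P]_(x in A) (w x)%:E =
        \int[P]_(x in B) (w x)%:E + \int[P]_(x in A `\` B) (w x)%:E.
      rewrite -ge0_integral_setU//.
      + by rewrite setDUK.
      + exact: measurableD.
      + exact: measurable_funS mw.
      + by move=> x _; rewrite lee_fin.
      + by apply/disj_setPS => x [Bx []].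
    rewrite addeAC subee ?add0e//; apply: integrable_fin_num => //.
    exact: integrableS iw.
  by rewrite !cut// eA eB.
- move=> F ndF DF; split; first by apply: bigcup_measurable => i _; case: (DF i).
  have lim w : P.-integrable setT (EFin \o w) -> (forall x, 0 <= w x)%R ->
      \int[P]_(x in F i) (w x)%:E @[i --> \oo] -->
      \int[P]_(x in \bigcup_i F i) (w x)%:E.
    move=> iw w0; apply: ge0_nondecreasing_set_cvg_integral => //.
    + by move=> i; case: (DF i).
    + by move=> i; apply: measurable_funS (measurable_int _ iw).
    + by move=> i x _; rewrite lee_fin.
  apply: cvg_unique (lim u iu u0) _ => //.
  rewrite (_ : (fun i => \int[P]_(x in F i) (u x)%:E) =
    (fun i => \int[P]_(x in F i) (v x)%:E)); first exact: lim.
  by apply/funext => i; case: (DF i).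
Qed.

End pi_lambda.

Lemma integral_mul_indic {R : realType} {d} {T : measurableType d}
    (mu : {measure set T -> \bar R}) (D : set T) (f : T -> R) :
  \int[mu]_(x in D) (f x)%:E = \int[mu]_x (\1_D x * f x)%:E.
Proof.
rewrite integral_mkcond; apply: eq_integral => x _.
by rewrite patchE indicE; case: ifP; rewrite ?mul1r ?mul0r.
Qed.

Section conditional_laws.
Context {R : realType} {d : measure_display} {T : measurableType d}.
Variables (P : probability T R) (G H : set_system T).
Hypotheses (sG : sigma_subalgebra G) (sH : sigma_subalgebra H).
Hypothesis HG : H `<=` G.
Variable X : T -> R.
Hypothesis mX : measurable_fun setT X.
Hypothesis lawX : same_cond_law P G H X.

(** A pi-system generating sigma(X, H). *)
Definition rectangles : set_system T :=
  [set D | exists B C, [/\ measurable B, H C & D = X @^-1` B `&` C]].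

Let mXB B : measurable B -> measurable (X @^-1` B).
Proof. by move=> mB; rewrite -[X in measurable X]setTI; exact: mX. Qed.

Let HT : H setT.
Proof. by rewrite -(sub_sigma_measurableE sH); exact: measurableT. Qed.

Let HI A B : H A -> H B -> H (A `&` B).
Proof. by rewrite -(sub_sigma_measurableE sH); exact: measurableI. Qed.

Let rectI : setI_closed rectangles.
Proof.
move=> _ _ [B [C [mB HC ->]]] [B' [C' [mB' HC' ->]]].
exists (B `&` B'), (C `&` C'); split; [exact: measurableI|exact: HI|].
by rewrite preimage_setI setIACA.
Qed.

Let rect_m : rectangles `<=` measurable.
Proof. by move=> _ [B [C [mB HC ->]]]; apply: measurableI; [exact: mXB|exact: sH.2]. Qed.

Lemma sub_sigma_rectangles : sigma_subalgebra <<s rectangles >>.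
Proof.
split; first exact: smallest_sigma_algebra.
by apply: smallest_sub rect_m; exact: sigma_algebra_measurable.
Qed.

Lemma measurable_wrt_rectangles_X : measurable_wrt <<s rectangles >> X.
Proof.
by move=> B mB; apply: sub_sigma_algebra; exists B, setT; rewrite setIT.
Qed.

Lemma sub_rectangles : H `<=` <<s rectangles >>.
Proof.
move=> C HC; apply: sub_sigma_algebra; exists setT, C.
by rewrite preimage_setT setTI.
Qed.

(** On a rectangle {X in B} /\ C both sides equal the integral over C of a times
    the conditional probability of {X in B}: on the left this probability is
    first taken given G, where A is known, and the two conditional laws
    coincide. So a version a of P(A | H) is also a version of P(A | X, H). *)
Let cond_prob_rect A (a : T -> R) : G A -> measurable_wrt H a ->
  (forall x, 0 <= a x)%R -> P.-integrable setT (EFin \o a) ->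
  (forall C, H C -> \int[P]_(x in C) (a x)%:E = P (A `&` C)) ->
  forall D, <<s rectangles >> D ->
  \int[P]_(x in D) (\1_A x)%:E = \int[P]_(x in D) (a x)%:E.
Proof.
move=> GA Ha a0 ia aE.
have mA : measurable A by exact: sG.2.
have ma : measurable_fun setT a by exact: measurable_wrt_measurable Ha.
have [k [l [kG lH kl]]] := lawX.
apply: integral_pi_lambda => //.
- by exists setT, setT; rewrite preimage_setT setIT.
- exact: integrable_indic.
move=> _ [B [C [mB HC ->]]].
have mC : measurable C by exact: sH.2.
have [_ ik kmeas kE] := kG B mB.
have [_ il lmeas lE] := lH B mB.
have ml : measurable_fun setT (fun w => fine (l w B)).
  by apply: (measurable_wrt_measurable sH).
have l0 w : (0 <= fine (l w B))%R by exact: fine_ge0.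
have indH : measurable_wrt H (\1_C : T -> R).
  apply/(measurable_wrtP sH); apply: measurable_indic.
  by rewrite sub_sigma_measurableE.
have fH (f : T -> R) : measurable_wrt H f -> measurable_wrt H (fun w => \1_C w * f w)%R.
  by move=> /(measurable_wrtP sH) mf; apply/(measurable_wrtP sH)/measurable_funM => //;
    exact/(measurable_wrtP sH).
have f0 (f : T -> R) : (forall w, 0 <= f w)%R -> forall w, (0 <= \1_C w * f w)%R.
  by move=> h w; rewrite mulr_ge0.
rewrite integral_indic//; last by apply: measurableI => //; exact: mXB.
have -> : A `&` (X @^-1` B `&` C) = X @^-1` B `&` (A `&` C) by rewrite setICA.
have mAC : measurable (A `&` C) by exact: measurableI.
have GAC : G (A `&` C).
  rewrite -(sub_sigma_measurableE sG); apply: measurableI;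
    rewrite sub_sigma_measurableE//; exact: HG.
rewrite -[LHS]integral_indic//; last exact: mXB.
rewrite -kE// (@ae_eq_integral _ _ _ _ _ (fun w => (fine (l w B))%:E))//; last 3 first.
- by apply/measurable_EFinP/measurable_funTS/(measurable_wrt_measurable sG).
- exact/measurable_EFinP/measurable_funTS.
- by apply: filterS kl => w klw _; rewrite klw.
transitivity (\int[P]_w ((\1_C w * fine (l w B)) * \1_A w)%:E).
  rewrite integral_mul_indic; apply: eq_integral => w _.
  by rewrite indicI /=; congr EFin; ring.
rewrite (ge0_integral_take_out sH _ ma _ a0)//; last 3 first.
- by move=> S HS; rewrite integral_indic ?aE//; exact: sH.2.
- exact: fH.
- exact: f0.
transitivity (\int[P]_w ((\1_C w * a w) * fine (l w B))%:E).
  by apply: eq_integral => w _; rewrite mulrAC.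
rewrite (ge0_integral_take_out sH ml (v := \1_(X @^-1` B)))//; last 3 first.
- by apply: measurable_indic; exact: mXB.
- exact: fH.
- exact: f0.
rewrite [RHS]integral_mul_indic; apply: eq_integral => w _.
by rewrite indicI /=; congr EFin; ring.
Qed.

(** Integrating a function of (X, H) over a G-event A is integrating it against
    the weight P(A | H), by the previous lemma; and this weight is
    H-measurable, so that averages over the events of H decide. *)
Lemma cond_law_integral_eq (u v : T -> R) :
  measurable_wrt <<s rectangles >> u -> measurable_wrt <<s rectangles >> v ->
  (forall x, 0 <= u x)%R -> (forall x, 0 <= v x)%R ->
  (forall C, H C -> \int[P]_(x in C) (u x)%:E = \int[P]_(x in C) (v x)%:E) ->
  forall A, G A -> \int[P]_(x in A) (u x)%:E = \int[P]_(x in A) (v x)%:E.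
Proof.
move=> Ku Kv u0 v0 uv A GA.
have mA : measurable A by exact: sG.2.
have mid := measurable_id_sub sH.
pose p : {mfun T >-> g_sigma_algebraType H} := HB.pack (id : T -> g_sigma_algebraType H)
  (isMeasurableFun.Build _ _ _ _ _ mid).
have [a [Ha a0 ia aE]] : exists a : T -> R, [/\ measurable_wrt H a,
    forall x, (0 <= a x)%R, P.-integrable setT (EFin \o a) &
    forall C, H C -> \int[P]_(x in C) (a x)%:E = P (A `&` C)].
  have [a [ma a0 ia aE]] := ex_cond_prob P p mA.
  exists a; split => //; first exact/(measurable_wrtP sH).
  by move=> C HC; apply: aE; rewrite sub_sigma_measurableE.
have mat := measurable_wrt_measurable sH Ha.
have KaE := cond_prob_rect GA Ha a0 ia aE.
have sK := sub_sigma_rectangles.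
have mu_ := measurable_wrt_measurable sK Ku.
have mv := measurable_wrt_measurable sK Kv.
have swap w : measurable_wrt <<s rectangles >> w -> (forall x, 0 <= w x)%R ->
    \int[P]_(x in A) (w x)%:E = \int[P]_x (a x * w x)%:E.
  move=> Kw w0; have mw := measurable_wrt_measurable sK Kw.
  transitivity (\int[P]_x (w x * \1_A x)%:E).
    by rewrite integral_mul_indic; apply: eq_integral => x _; rewrite mulrC.
  rewrite (ge0_integral_take_out sK _ mat _ a0)//.
  by apply: eq_integral => x _; rewrite mulrC.
by rewrite !swap//; exact: (ge0_integral_take_out sH).
Qed.

End conditional_laws.

(** * Conditional means and variances as orthogonality relations *)

Section conditional_expectation.
Context {R : realType} {d : measure_display} {T : measurableType d}.
Variables (P : probability T R).

Lemma ae_ge0_integral (f : T -> R) : P.-integrable setT (EFin \o f) ->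
  {ae P, forall w, (0 <= f w)%R} -> 0 <= \int[P]_w (f w)%:E.
Proof.
move=> fi f0; have mf := measurable_int _ fi.
rewrite (@ae_eq_integral _ _ _ _ _ (fun w => (Num.max (f w) 0)%:E))//.
- by apply: integral_ge0 => w _; rewrite lee_fin le_max lexx orbT.
- by apply/measurable_EFinP/measurable_maxr => //; exact/measurable_EFinP.
- by apply: filterS f0 => w fw0 _ /=; rewrite max_l.
Qed.

Variable (H : set_system T).
Hypothesis sH : sigma_subalgebra H.

(** The hypothesis applies to the event where Y is negative, which lies in H. *)
Lemma ae_ge0_of_integral (Y : T -> R) : measurable_wrt H Y ->
  P.-integrable setT (EFin \o Y) ->
  (forall C, H C -> 0 <= \int[P]_(w in C) (Y w)%:E) ->
  {ae P, forall w, (0 <= Y w)%R}.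
Proof.
move=> mY iY Y0.
pose A := Y @^-1` [set y | (y < 0)%R].
have HA : H A by apply: mY; rewrite -set_itvNyo; exact: measurable_itv.
have mA : measurable A by exact: sH.2.
have iYA : P.-integrable A (EFin \o Y) by exact: integrableS iY.
have : \int[P]_(w in A) `|(Y w)%:E| = 0.
  apply/eqP; rewrite eq_le integral_ge0// andbT.
  rewrite (eq_integral (fun w => - (Y w)%:E)); last first.
    by move=> w; rewrite inE => /= Yw; rewrite ltr0_norm.
  rewrite integralN/=; first by rewrite oppe_le0; exact: Y0.
  by apply: integrable_add_def.
move/(ae_eq_integral_abs _ mA (measurable_int _ iYA)).
apply: filterS => w Yw; rewrite leNgt; apply/negP => Yw0.
by have := Yw Yw0 => -[] Y0w; move: Yw0; rewrite Y0w ltxx.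
Qed.

Lemma cond_exp_unique (X M M' : T -> R) :
  is_cond_exp P H X M -> is_cond_exp P H X M' -> {ae P, forall w, M w = M' w}.
Proof.
have le (N N' : T -> R) : is_cond_exp P H X N -> is_cond_exp P H X N' ->
    {ae P, forall w, (0 <= N w - N' w)%R}.
  move=> [iX iN mN NE] [_ iN' mN' N'E].
  apply: ae_ge0_of_integral.
  - apply/(measurable_wrtP sH)/measurable_funB; exact/(measurable_wrtP sH).
  - exact: integrableB iN iN'.
  move=> C HC; have mC : measurable C by exact: sH.2.
  under eq_integral do rewrite EFinB.
  rewrite integralB//; [|exact: integrableS iN|exact: integrableS iN'].
  rewrite NE// N'E// subee//; apply: integrable_fin_num => //.
  exact: integrableS iX.
move=> cM cM'; move: (le _ _ cM cM') (le _ _ cM' cM); apply: filterS2 => w.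
by rewrite !subr_ge0 => h1 h2; apply/eqP; rewrite eq_le h1 h2.
Qed.

Lemma cond_exp_ge0 (X M : T -> R) : (forall w, 0 <= X w)%R ->
  is_cond_exp P H X M -> {ae P, forall w, (0 <= M w)%R}.
Proof.
move=> X0 [iX iM mM ME]; apply: ae_ge0_of_integral => // C HC.
by rewrite ME//; apply: integral_ge0 => w _; rewrite lee_fin.
Qed.

Variables (G : set_system T) (X : T -> R).
Hypotheses (sG : sigma_subalgebra G) (HG : H `<=` G).
Hypothesis (lawX : same_cond_law P G H X).
Hypothesis mX : measurable_fun setT X.

Let K := <<s rectangles H X >>.

Let sK : sigma_subalgebra K. Proof. exact: sub_sigma_rectangles. Qed.

Let HK (f : T -> R) : measurable_wrt H f ->
  measurable_fun setT (f : g_sigma_algebraType K -> R).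
Proof.
move=> Hf; apply/(measurable_wrtP sK) => B mB.
by apply: sub_rectangles; exact: Hf.
Qed.

Let XK : measurable_fun setT (X : g_sigma_algebraType K -> R).
Proof. by apply/(measurable_wrtP sK); exact: measurable_wrt_rectangles_X. Qed.

(** The positive and negative parts of X - M are nonnegative functions of
    (X, H) that agree on average over H, hence also over the larger G. *)
Lemma cond_exp_orthogonal (M f : T -> R) : is_cond_exp P H X M ->
  measurable_wrt G f -> P.-integrable setT (fun w => (f w * (X w - M w))%:E) ->
  \int[P]_w (f w * (X w - M w))%:E = 0.
Proof.
move=> [iX iM mM ME] mf ifXM.
pose u w := Num.max (X w - M w)%R 0%R.
pose v w := Num.max (- (X w - M w))%R 0%R.
have uvE w : (X w - M w = u w - v w)%R.
  by rewrite /u /v; case: (leP (X w - M w) 0)%R;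
    case: (leP (- (X w - M w)) 0)%R => *; lra.
have u0 w : (0 <= u w)%R by rewrite le_max lexx orbT.
have v0 w : (0 <= v w)%R by rewrite le_max lexx orbT.
have uL w : (u w <= `|X w - M w|)%R by rewrite ge_max ler_norm normr_ge0.
have vL w : (v w <= `|X w - M w|)%R by rewrite ge_max -normrN ler_norm normr_ge0.
have Ku : measurable_wrt K u.
  apply/(measurable_wrtP sK)/measurable_maxr => //.
  by apply: measurable_funB => //; exact: HK.
have Kv : measurable_wrt K v.
  apply/(measurable_wrtP sK)/measurable_maxr => //.
  by apply: measurableT_comp => //; apply: measurable_funB => //; exact: HK.
have mu_ := measurable_wrt_measurable sK Ku.
have mv := measurable_wrt_measurable sK Kv.
have iXM : P.-integrable setT (fun w => (X w - M w)%:E).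
  exact: integrableB iX iM.
have iu : P.-integrable setT (fun w => (u w)%:E).
  apply: le_integrable iXM => //; first exact/measurable_EFinP.
  by move=> w _; rewrite /= lee_fin ger0_norm.
have iv : P.-integrable setT (fun w => (v w)%:E).
  apply: le_integrable iXM => //; first exact/measurable_EFinP.
  by move=> w _; rewrite /= lee_fin ger0_norm.
have mfT := measurable_wrt_measurable sG mf.
have ifu : P.-integrable setT (fun w => (f w * u w)%:E).
  apply: le_integrable ifXM => //; first exact/measurable_EFinP/measurable_funM.
  by move=> w _; rewrite /= lee_fin !normrM ler_wpM2l// ger0_norm.
have uvC C : H C -> \int[P]_(w in C) (u w)%:E = \int[P]_(w in C) (v w)%:E.
  move=> HC; have mC : measurable C by exact: sH.2.
  have : \int[P]_(w in C) ((X w)%:E - (M w)%:E) = 0.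
    rewrite integralB//; [|exact: integrableS iX|exact: integrableS iM].
    by rewrite ME// subee//; apply: integrable_fin_num => //; exact: integrableS iX.
  under eq_integral do rewrite -EFinB uvE EFinB.
  rewrite integralB//; [|exact: integrableS iu|exact: integrableS iv].
  have fu : \int[P]_(w in C) (u w)%:E \is a fin_num.
    by apply: integrable_fin_num => //; exact: integrableS iu.
  have fv : \int[P]_(w in C) (v w)%:E \is a fin_num.
    by apply: integrable_fin_num => //; exact: integrableS iv.
  by move=> /eqP; rewrite sube_eq ?add0e ?fin_num_adde_defl// => /eqP.
have [ifv fuv] := integral_take_out sG mu_ mv u0 v0
  (cond_law_integral_eq sG sH HG mX lawX Ku Kv u0 v0 uvC) mf ifu.
under eq_integral do rewrite uvE mulrBr EFinB.
rewrite integralB//= fuv subee//; exact: integrable_fin_num.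
Qed.

(** The truncation of V at 0 only changes it on a null set, and makes it a weight.
    The definition of the conditional variance carries its own version of the
    conditional mean, which is almost surely M. *)
Lemma cond_var_orthogonal (M V f : T -> R) : is_cond_exp P H X M ->
  is_cond_var P H X V ->
  measurable_wrt G f ->
  P.-integrable setT (fun w => (f w * (X w - M w) ^+ 2)%:E) ->
  P.-integrable setT (fun w => (f w * Num.max (V w) 0)%:E) /\
  \int[P]_w (f w * ((X w - M w) ^+ 2 - Num.max (V w) 0))%:E = 0.
Proof.
move=> cM [M' cM' cV] mf ifu.
have [_ _ mM _] := cM.
have MM' := cond_exp_unique cM cM'.
have V0 := cond_exp_ge0 (fun w => sqr_ge0 _) cV.
have [iS iV mV VE] := cV.
pose u w := ((X w - M w) ^+ 2)%R.
pose v w := Num.max (V w) 0%R.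
have u0 w : (0 <= u w)%R by exact: sqr_ge0.
have v0 w : (0 <= v w)%R by rewrite le_max lexx orbT.
have Ku : measurable_wrt K u.
  apply/(measurable_wrtP sK)/measurable_funX.
  by apply: measurable_funB => //; exact: HK.
have Kv : measurable_wrt K v.
  by apply/(measurable_wrtP sK)/measurable_maxr => //; exact: HK.
have mu_ := measurable_wrt_measurable sK Ku.
have mv := measurable_wrt_measurable sK Kv.
have uvC C : H C -> \int[P]_(w in C) (u w)%:E = \int[P]_(w in C) (v w)%:E.
  move=> HC; have mC : measurable C by exact: sH.2.
  transitivity (\int[P]_(w in C) ((X w - M' w) ^+ 2)%:E).
    apply: ae_eq_integral => //.
    - exact/measurable_EFinP/measurable_funTS.
    - by apply: measurable_funTS; exact: measurable_int iS.
    - by apply: filterS MM' => w MM'w _; rewrite /u MM'w.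
  rewrite -VE//; apply: ae_eq_integral => //.
  - by apply: measurable_funTS; exact: measurable_int iV.
  - exact/measurable_EFinP/measurable_funTS.
  - by apply: filterS V0 => w V0w _; rewrite /v max_l.
have [ifv fuv] := integral_take_out sG mu_ mv u0 v0
  (cond_law_integral_eq sG sH HG mX lawX Ku Kv u0 v0 uvC) mf ifu.
split => //.
under eq_integral do rewrite mulrBr EFinB.
rewrite integralB//= fuv subee//; exact: integrable_fin_num.
Qed.

End conditional_expectation.

(** * Gaussian integrals *)

Section gaussian.
Context {R : realType}.
Notation mu := (@lebesgue_measure R).
Notation phi := (@normal_pdf R 0 1).

Lemma gaussE x : phi x = (normal_peak 1 * expR (- x ^+ 2 / 2))%R.
Proof.
rewrite normal_pdfE ?oner_neq0// /normal_fun subr0 expr1n.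
by rewrite -mulr_natl mulr1.
Qed.

Lemma gauss_gt0 x : (0 < phi x)%R.
Proof. by rewrite gaussE mulr_gt0 ?expR_gt0// normal_peak_gt0// oner_neq0. Qed.

Lemma gaussN x : phi (- x)%R = phi x.
Proof. by rewrite !gaussE sqrrN. Qed.

Lemma continuous_gauss : continuous phi.
Proof. by apply: continuous_normal_pdf; rewrite oner_neq0. Qed.

Lemma is_derive_gauss (x : R) : is_derive x (1 : R)%R phi (- (x * phi x))%R.
Proof.
have -> : phi = (fun y => normal_peak 1 * expR (- y ^+ 2 / 2))%R.
  by apply/funext => y; exact: gaussE.
by apply: is_derive_eq; rewrite /GRing.scale /=; field.
Qed.

Lemma gauss_cvgy : phi x @[x --> +oo%R] --> (0 : R)%R.
Proof.
have -> : phi = (fun y => normal_peak 1 * expR (- (y ^+ 2 / 2)))%R.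
  by apply/funext => y; rewrite gaussE mulNr.
rewrite -[X in _ --> X](mulr0 (normal_peak (1 : R)%R)).
apply: cvgM; first exact: cvg_cst.
apply: (@cvg_comp _ _ _ (fun y => y ^+ 2 / 2)%R (fun y => expR (- y))%R _
  (pinfty_nbhs R)); last exact: cvgr_expR.
by apply: gt0_cvgMly; [rewrite invr_gt0|exact: cvgr_expr2].
Qed.


Let mphi (D : set R) : measurable_fun D phi.
Proof. by apply: measurable_funTS; exact: measurable_normal_pdf. Qed.

Lemma integral_mul_gauss_y (x : R) :
  (0 <= x)%R -> \int[mu]_(t in `[x, +oo[) (t * phi t)%:E = (phi x)%:E.
Proof.
move=> x0.
rewrite (@ge0_continuous_FTC2y _ _ (fun t => - phi t)%R _ 0%R).
- by rewrite EFinN oppeK add0e.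
- by move=> t xt; rewrite mulr_ge0 ?(ltW (gauss_gt0 _))// (le_trans x0).
- apply: continuous_subspaceT => t; apply: cvgM; first exact: cvg_id.
  exact: continuous_gauss.
- by rewrite -[X in _ --> X]oppr0; apply: cvgN; exact: gauss_cvgy.
- by move=> t xt; have /@is_deriveN[] := is_derive_gauss t.
- by apply: cvgN; apply: cvg_at_right_filter; exact: continuous_gauss.
- move=> t _; rewrite derive1E.
  by have /@is_deriveN[_ ->] := is_derive_gauss t; rewrite opprK.
Qed.

Lemma integral_mul_gauss_Ny (x : R) : (x <= 0)%R ->
  \int[mu]_(t in `]-oo, x]) (- t * phi t)%:E = (phi x)%:E.
Proof.
move=> x0; rewrite -(gaussN x) -[in LHS](opprK x) ge0_integration_by_substitutionNy.
- have Nx0 : (0 <= - x)%R by rewrite oppr_ge0.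
  rewrite -[RHS](integral_mul_gauss_y Nx0).
  by apply: eq_integral => t _ /=; rewrite opprK gaussN.
- apply: continuous_subspaceT => t; apply: cvgM; last exact: continuous_gauss.
  by apply: cvgN; exact: cvg_id.
- move=> t; rewrite opprK in_itv/= => tx.
  by rewrite mulr_ge0 ?(ltW (gauss_gt0 _))// oppr_ge0 (le_trans (ltW tx)).
Qed.

Lemma integral_gauss_Ny (x : R) :
  \int[mu]_(t in `]-oo, x]) (phi t)%:E = \int[mu]_(t in `[(- x)%R, +oo[) (phi t)%:E.
Proof.
rewrite -[in LHS](opprK x) ge0_integration_by_substitutionNy.
- by apply: eq_integral => t _ /=; rewrite gaussN.
- by apply: continuous_subspaceT => t; exact: continuous_gauss.
- by move=> t _; exact: ltW (gauss_gt0 _).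
Qed.

Lemma integrable_gauss : mu.-integrable setT (EFin \o phi).
Proof. exact: integrable_normal_pdf. Qed.

Lemma integrable_mul_gauss : mu.-integrable setT (fun t => (t * phi t)%:E).
Proof.
apply/integrableP; split.
  by apply/measurable_EFinP/measurable_funM => //; exact: mphi.
have E : (fun t : R => `|(t * phi t)%:E|) = (fun t => (`|t| * phi t)%:E).
  by apply/funext => t /=; rewrite normrM (gtr0_norm (gauss_gt0 _)).
rewrite E ge0_symfun_integralT.
- rewrite (_ : [set x | (0 <= x)%R] = `[0%R, +oo[%classic); last first.
    by rewrite set_itvcy.
  have -> : \int[mu]_(t in `[0%R, +oo[) (`|t| * phi t)%:E =
      \int[mu]_(t in `[0%R, +oo[) (t * phi t)%:E.
    by apply: eq_integral => t; rewrite inE/= in_itv/= andbT => t0; rewrite ger0_norm.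
  by rewrite integral_mul_gauss_y// -EFinM ltry.
- by move=> t; rewrite mulr_ge0// ltW// gauss_gt0.
- move=> t; apply: cvgM; last exact: continuous_gauss.
  by apply: norm_continuous.
- by move=> t /=; rewrite normrN gaussN.
Qed.

Lemma is_derive_ratio (t : R) : t != 0%R ->
  is_derive t (1 : R)%R (fun t => - (phi t / t))%R ((1 + t ^- 2) * phi t)%R.
Proof.
move=> t0; have dV := is_deriveV t0 (is_derive_id t (1 : R)%R).
have := is_deriveN (is_deriveM (is_derive_gauss t) dV).
by move/is_derive_eq; apply; rewrite /GRing.scale /=; field.
Qed.

(** Mills' inequality: - phi t / t is a primitive of (1 + t^-2) phi t, and
    1 + t^-2 <= 1 + x^-2 on the half-line. *)
Lemma mills (x : R) : (0 < x)%R ->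
  (x * phi x)%:E <= (1 + x ^+ 2)%:E * \int[mu]_(t in `[x, +oo[) (phi t)%:E.
Proof.
move=> x0.
have x2 : (0 < x ^+ 2)%R by rewrite exprn_gt0.
have cf : {within `[x, +oo[, continuous (fun t => (1 + t ^- 2) * phi t)%R}.
  apply: continuous_in_subspaceT => t; rewrite inE/= in_itv/= andbT => xt.
    have t0 : (t != 0)%R by rewrite gt_eqF// (lt_le_trans x0).
    apply: cvgM; last exact: continuous_gauss.
    apply: cvgD; first exact: cvg_cst.
    by apply: cvgV; [rewrite expf_neq0|exact: exprn_continuous].
have : \int[mu]_(t in `[x, +oo[) ((1 + t ^- 2) * phi t)%:E = (phi x / x)%:E.
  rewrite (@ge0_continuous_FTC2y _ _ (fun t => - (phi t / t))%R _ 0%R).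
  - by rewrite EFinN oppeK add0e.
  - move=> t xt; rewrite mulr_ge0 ?(ltW (gauss_gt0 _))// addr_ge0// invr_ge0.
    exact: sqr_ge0.
  - exact: cf.
  - rewrite -[X in _ --> X]oppr0; apply: cvgN.
    rewrite -[X in _ --> X](mulr0 (0 : R)%R); apply: cvgM; first exact: gauss_cvgy.
    by apply/gtr0_cvgV0; [exact: nbhs_pinfty_gt|exact: cvg_id].
  - move=> t xt; have t0 : (t != 0)%R by rewrite gt_eqF// (lt_trans x0).
    by have [] := is_derive_ratio t0.
  - apply: cvg_at_right_filter; apply: cvgN; apply: cvgM; first exact: continuous_gauss.
    by apply: cvgV; [rewrite gt_eqF|exact: cvg_id].
  - move=> t; rewrite in_itv/= andbT => xt.
    have t0 : (t != 0)%R by rewrite gt_eqF// (lt_trans x0).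
    by rewrite derive1E; have [_ ->] := is_derive_ratio t0.
move=> phixE.
have le : (phi x / x)%:E <= (1 + x ^- 2)%:E * \int[mu]_(t in `[x, +oo[) (phi t)%:E.
  rewrite -phixE -ge0_integralZl//=; last 3 first.
  - by apply/measurable_EFinP; exact: mphi.
  - by move=> t _; rewrite lee_fin ltW// gauss_gt0.
  - by rewrite lee_fin addr_ge0// invr_ge0 sqr_ge0.
  apply: ge0_le_integral => //=.
  - by move=> t _; rewrite lee_fin mulr_ge0 ?addr_ge0 ?invr_ge0 ?sqr_ge0// ltW// gauss_gt0.
  - by apply/measurable_EFinP; exact: subspace_continuous_measurable_fun.
  - by apply/measurable_EFinP/measurable_funM => //; exact: mphi.
  - move=> t; rewrite in_itv/= andbT => xt.
    rewrite lee_fin ler_wpM2r ?(ltW (gauss_gt0 _))// lerD2l.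
    rewrite lef_pV2 ?posrE ?exprn_gt0 ?(lt_le_trans x0)//.
    by rewrite lerXn2r// nnegrE ltW// (lt_le_trans x0).
have -> : (x * phi x)%:E = (x ^+ 2)%:E * (phi x / x)%:E.
  by rewrite -EFinM; congr EFin; field; rewrite gt_eqF.
have -> : (1 + x ^+ 2)%R = (x ^+ 2 * (1 + x ^- 2))%R.
  by field; rewrite gt_eqF.
rewrite [X in _ <= X * _]EFinM -muleA; apply: lee_wpmul2l => //.
by rewrite lee_fin ltW.
Qed.

End gaussian.

Section gaussian_tails.
Context {R : realType}.
Notation mu := (@lebesgue_measure R).
Notation phi := (@normal_pdf R 0 1).

Definition lower (f : R -> R) (x : R) : R := (\int[mu]_(t in `]-oo, x]) f t)%R.
Definition upper (f : R -> R) (x : R) : R := (\int[mu]_(t in `]x, +oo[) f t)%R.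

Let cut (x : R) : `]-oo, x] `|` `]x, +oo[ = [set: R].
Proof. by rewrite -setCitvl setUv. Qed.

Lemma lowerDupper (f : R -> R) x : mu.-integrable setT (EFin \o f) ->
  (lower f x + upper f x = \int[mu]_t f t)%R.
Proof.
move=> fi; rewrite -(cut x) Rintegral_setU//=.
- by rewrite cut.
- by rewrite -setCitvl; exact/disj_setPCl.
Qed.

Section linearity.
Variables (f g : R -> R) (x : R).
Hypotheses (fi : mu.-integrable setT (EFin \o f)) (gi : mu.-integrable setT (EFin \o g)).

Let iS D (h : R -> R) : measurable D -> mu.-integrable setT (EFin \o h) ->
  mu.-integrable D (EFin \o h).
Proof. by move=> mD; exact: integrableS. Qed.

Lemma lowerB : lower (fun t => f t - g t)%R x = (lower f x - lower g x)%R.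
Proof. by rewrite /lower RintegralB//; exact: iS. Qed.

Lemma upperB : upper (fun t => f t - g t)%R x = (upper f x - upper g x)%R.
Proof. by rewrite /upper RintegralB//; exact: iS. Qed.

Lemma lowerZ c : lower (fun t => c * f t)%R x = (c * lower f x)%R.
Proof. by rewrite /lower RintegralZl//; exact: iS. Qed.

Lemma upperZ c : upper (fun t => c * f t)%R x = (c * upper f x)%R.
Proof. by rewrite /upper RintegralZl//; exact: iS. Qed.

Lemma lower_le : (forall t, t <= x -> `|f t| <= g t)%R -> (`|lower f x| <= lower g x)%R.
Proof.
move=> fg; apply: le_trans (le_normr_Rintegral _ _) _ => //; first exact: iS.
apply: le_Rintegral => //; first by apply: integrable_norm; exact: iS.
  exact: iS.
Qed.

Lemma upper_le : (forall t, x <= t -> `|f t| <= g t)%R -> (`|upper f x| <= upper g x)%R.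
Proof.
move=> fg; apply: le_trans (le_normr_Rintegral _ _) _ => //; first exact: iS.
apply: le_Rintegral => //; first by apply: integrable_norm; exact: iS.
  exact: iS.
by move=> t; rewrite /= in_itv/= andbT => /ltW; exact: fg.
Qed.

End linearity.

Let Igauss := @integrable_gauss R.
Let Imul := @integrable_mul_gauss R.

Lemma gauss_total : (\int[mu]_t phi t = 1)%R.
Proof. by rewrite /Rintegral integral_normal_pdf. Qed.

Lemma upper_gaussE x : upper phi x = fine (\int[mu]_(t in `[x, +oo[) (phi t)%:E).
Proof. by rewrite /upper Rintegral_itv_obnd_cbnd//; exact: integrableS Igauss. Qed.

Lemma lower_gaussE x : lower phi x = upper phi (- x)%R.
Proof. by rewrite upper_gaussE -integral_gauss_Ny. Qed.

Let mulphi : R -> R := (fun t => t * phi t)%R.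

Let upper0 x : (0 <= x)%R -> upper mulphi x = phi x.
Proof.
move=> x0; rewrite /upper Rintegral_itv_obnd_cbnd.
  by rewrite /Rintegral integral_mul_gauss_y.
exact: integrableS Imul.
Qed.

Let lower0 x : (x <= 0)%R -> lower mulphi x = (- phi x)%R.
Proof.
move=> x0; rewrite -[LHS]opprK; congr (- _)%R.
have := @integral_mul_gauss_Ny R x x0 => E.
rewrite -[RHS]/(fine (phi x)%:E) -E -mulN1r -lowerZ//.
by rewrite /lower /Rintegral; congr fine; apply: eq_integral => t _;
   rewrite mulN1r mulNr.
Qed.

Let mul_total : (\int[mu]_t mulphi t = 0)%R.
Proof. by rewrite -(lowerDupper 0)// lower0// upper0// addNr. Qed.

(** [- phi] is a primitive of [t * phi t]. On a half-line where the integrand has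
    constant sign the fundamental theorem applies directly; the other half-lines
    are complements of these, and the total integral vanishes. *)
Lemma upper_mul_gauss x : upper mulphi x = phi x.
Proof.
have [x0|x0] := leP 0%R x; first exact: upper0.
have := lowerDupper x Imul; rewrite -/mulphi mul_total lower0 ?ltW//.
by move/eqP; rewrite addrC subr_eq0 => /eqP.
Qed.

Lemma lower_mul_gauss x : lower mulphi x = (- phi x)%R.
Proof.
have := lowerDupper x Imul; rewrite -/mulphi mul_total upper_mul_gauss.
by move/eqP; rewrite addr_eq0 => /eqP.
Qed.

Lemma upper_gauss_ge0 x : (0 <= upper phi x)%R.
Proof. by apply: Rintegral_ge0 => t _; exact: normal_pdf_ge0. Qed.

Lemma mills_upper x : (x * phi x <= (1 + x ^+ 2) * upper phi x)%R.
Proof.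
have [x0|x0] := leP x 0%R.
  apply: (@le_trans _ _ 0%R); first by rewrite mulr_le0_ge0// normal_pdf_ge0.
  by rewrite mulr_ge0 ?upper_gauss_ge0// addr_ge0// sqr_ge0.
have := mills x0; rewrite upper_gaussE.
have fin : \int[mu]_(t in `[x, +oo[) (phi t)%:E \is a fin_num.
  by apply: integrable_fin_num => //; exact: integrableS Igauss.
by rewrite -{1}(fineK fin) -EFinM lee_fin.
Qed.

Lemma mills_lower x : (- (x * phi x) <= (1 + x ^+ 2) * lower phi x)%R.
Proof.
by have := mills_upper (- x)%R; rewrite lower_gaussE sqrrN gaussN mulNr.
Qed.

End gaussian_tails.

(** * Stein's equation *)

Section stein_equation.
Context {R : realType}.
Notation mu := (@lebesgue_measure R).
Notation phi := (@normal_pdf R 0 1).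
Variable h : R -> R.
Hypothesis hL : forall s t, (`|h s - h t| <= `|s - t|)%R.

Let Igauss := @integrable_gauss R.
Let Imul := @integrable_mul_gauss R.

Let ch : continuous h.
Proof.
move=> x; apply/cvgrPdist_le => e e0; near=> t.
apply: le_trans (hL _ _) _; near: t.
by move: e e0; apply/cvgrPdist_le; exact: cvg_id.
Unshelve. all: by end_near. Qed.

Lemma measurable_lipschitz : measurable_fun setT h.
Proof. exact: continuous_measurable_fun. Qed.

Let mh := measurable_lipschitz.

Let IZ c : mu.-integrable setT (fun t => (c * phi t)%:E).
Proof. by under eq_fun do rewrite EFinM; exact: integrableZl. Qed.

Lemma integrable_lipschitz_gauss : mu.-integrable setT (fun t => (h t * phi t)%:E).
Proof.
have I : mu.-integrable setT (fun t => (`|h 0%R| * phi t)%:E + (`|(t * phi t)|)%:E).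
  apply: integrableD => //; exact: integrable_norm.
apply: le_integrable I => //.
  by apply/measurable_EFinP/measurable_funM => //; exact: measurable_normal_pdf.
move=> t _; rewrite -EFinD /= lee_fin !normrM (gtr0_norm (gauss_gt0 _)).
rewrite [leRHS]ger0_norm -?mulrDl; last by rewrite mulr_ge0// normal_pdf_ge0.
rewrite ler_wpM2r ?normal_pdf_ge0//.
have := hL t 0%R; rewrite subr0; have := ler_normD (h t - h 0)%R (h 0%R).
rewrite subrK; lra.
Qed.

Definition gauss_mean : R := (\int[mu]_t (h t * phi t))%R.

Let m := gauss_mean.

Definition stein_num (x : R) : R := lower (fun t => (h t - m) * phi t)%R x.

Definition stein_sol (x : R) : R := (stein_num x / phi x)%R.

(** The derivative of [stein_sol], read off from the equation that it solves. *)
Definition stein_der (x : R) : R := (h x - m + x * stein_sol x)%R.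

Let IB c : mu.-integrable setT (fun t => ((h t - c) * phi t)%:E).
Proof.
under eq_fun do rewrite mulrBl EFinB.
by apply: integrableB => //; exact: integrable_lipschitz_gauss.
Qed.

Lemma is_derive_stein_num (x : R) :
  is_derive x (1 : R)%R stein_num ((h x - m) * phi x)%R.
Proof.
have x1 : (x < x + 1)%R by rewrite ltrDl.
have [|||d1 d2] := @continuous_FTC1 R (fun t => (h t - m) * phi t)%R -oo%O x _ x1 _.
- exact: integrableS (IB m).
- exact: ltNyr.
- apply: cvgM; last exact: continuous_gauss.
  by apply: cvgB; [exact: ch|exact: cvg_cst].
by apply: DeriveDef; [exact: d1|rewrite -derive1E; exact: d2].
Qed.

Lemma is_derive_stein_sol (x : R) : is_derive x (1 : R)%R stein_sol (stein_der x).
Proof.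
have p0 : phi x != 0%R by rewrite gt_eqF// gauss_gt0.
have := is_deriveM (is_derive_stein_num x) (is_deriveV p0 (is_derive_gauss x)).
move/is_derive_eq; apply; rewrite /GRing.scale/= /stein_der /stein_sol.
by field.
Qed.

Let g (x : R) : R := (x * stein_sol x)%R.

Let dg (x : R) : R := (stein_sol x + x * stein_der x)%R.

Let is_derive_g (x : R) : is_derive x (1 : R)%R g (dg x).
Proof.
have := is_deriveM (is_derive_id x (1 : R)%R) (is_derive_stein_sol x).
by move/is_derive_eq; apply; rewrite /GRing.scale/= /dg; ring.
Qed.

(** The weights A and B below are nonnegative by Mills' inequality, and they do
    not depend on h, so that |phi x * dg x| is largest when h - h x is linear. *)
Let dg_le1 (x : R) : (`|dg x| <= 1)%R.
Proof.
have p0 : (0 < phi x)%R by exact: gauss_gt0.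
pose del t := ((h t - h x) * phi t)%R.
have Idel : mu.-integrable setT (EFin \o del) := IB (h x).
pose a := lower del x; pose b := upper del x.
pose L := lower phi x; pose U := upper phi x.
have LU : (L + U = 1)%R by rewrite lowerDupper// gauss_total.
have Ih := integrable_lipschitz_gauss.
(* h - h x is the only part of h that matters, since constants have stein_num 0 *)
have mE : (m - h x = a + b)%R.
  rewrite lowerDupper// /del; under eq_Rintegral do rewrite mulrBl.
  rewrite RintegralB//; last exact: IZ.
  by rewrite RintegralZl// gauss_total mulr1.
have numE : (stein_num x = a - (a + b) * L)%R.
  rewrite /stein_num -mE.
  have -> : (fun t => (h t - m) * phi t)%R = (fun t => del t - (m - h x) * phi t)%R.
    by apply/funext => t; rewrite /del; ring.
  by rewrite lowerB ?lowerZ//; exact: IZ.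
have aL : (`|a| <= x * L + phi x)%R.
  have -> : (x * L + phi x = lower (fun t => x * phi t - t * phi t) x)%R.
    by rewrite lowerB//; [rewrite lowerZ// lower_mul_gauss opprK|exact: IZ].
  apply: lower_le => //.
    exact: (integrableB measurableT (IZ x) Imul).
  move=> t tx; rewrite normrM (gtr0_norm (gauss_gt0 t)) -mulrBl.
  rewrite ler_wpM2r ?normal_pdf_ge0// (le_trans (hL _ _))//.
  by rewrite distrC ger0_norm// subr_ge0.
have bU : (`|b| <= phi x - x * U)%R.
  have -> : (phi x - x * U = upper (fun t => t * phi t - x * phi t) x)%R.
    by rewrite upperB//; [rewrite upperZ// upper_mul_gauss|exact: IZ].
  apply: upper_le => //.
    exact: (integrableB measurableT Imul (IZ x)).
  move=> t tx; rewrite normrM (gtr0_norm (gauss_gt0 t)) -mulrBl.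
  rewrite ler_wpM2r ?normal_pdf_ge0// (le_trans (hL _ _))//.
  by rewrite ger0_norm// subr_ge0.
pose A := ((1 + x ^+ 2) * U - x * phi x)%R.
pose B := ((1 + x ^+ 2) * L + x * phi x)%R.
have A0 : (0 <= A)%R by rewrite subr_ge0 mills_upper.
have B0 : (0 <= B)%R by have := mills_lower x; rewrite /B /L; lra.
have dgE : (phi x * dg x = A * a - B * b)%R.
  have -> : (phi x * dg x = (1 + x ^+ 2) * stein_num x - x * phi x * (m - h x))%R.
    rewrite /dg /stein_der /stein_sol; field.
    by rewrite gt_eqF.
  rewrite numE mE /A /B -(_ : 1 - L = U)%R; first by ring.
  by rewrite -LU addrC addKr.
have : (`|phi x * dg x| <= phi x)%R.
  rewrite dgE; apply: le_trans (ler_normB _ _) _.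
  rewrite !normrM (ger0_norm A0) (ger0_norm B0).
  have := ler_wpM2l A0 aL; have := ler_wpM2l B0 bU.
  (* the extremal value, attained at h t = x - t *)
  have : (A * (x * L + phi x) + B * (phi x - x * U) = phi x)%R.
    by rewrite /A /B -(_ : 1 - L = U)%R; [ring|rewrite -LU addrC addKr].
  lra.
by rewrite normrM (gtr0_norm p0) -[leRHS]mulr1 ler_pM2l.
Qed.

Let g_lip (x y : R) : (`|g x - g y| <= `|x - y|)%R.
Proof.
wlog xy : x y / (x <= y)%R.
  move=> wl; have [/wl//|/ltW/wl] := leP x y.
  by rewrite distrC (distrC y).
have [|c _ E] := @MVT_segment R g dg x y xy (fun z _ => is_derive_g z).
  apply: continuous_subspaceT => z; apply/differentiable_continuous/derivable1_diffP.
  by have [] := is_derive_g z.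
rewrite distrC E normrM (distrC x) -[leRHS]mul1r ler_wpM2r//.
Qed.

Lemma stein_der_lip (x y : R) : (`|stein_der x - stein_der y| <= 2 * `|x - y|)%R.
Proof.
have -> : (stein_der x - stein_der y = (h x - h y) + (g x - g y))%R.
  by rewrite /stein_der /g; ring.
have := ler_normD (h x - h y)%R (g x - g y)%R; have := hL x y; have := g_lip x y.
lra.
Qed.

(** The Lipschitz bound for [x * stein_sol x], which vanishes at 0, divided by x. *)
Lemma stein_sol_bounded (x : R) : (`|stein_sol x| <= 1 + `|stein_sol 0|)%R.
Proof.
have [->|x0] := eqVneq x 0%R; first by rewrite lerDr.
have : (`|x| * `|stein_sol x| <= `|x| * 1)%R.
  by have := g_lip x 0%R; rewrite /g mul0r !subr0 normrM mulr1.
by rewrite ler_pM2l ?normr_gt0// => /le_trans; apply; rewrite lerDl.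
Qed.

Lemma stein_eq (x : R) : (stein_der x - x * stein_sol x = h x - m)%R.
Proof. by rewrite /stein_der addrK. Qed.

Let continuous_sol : continuous stein_sol.
Proof.
move=> x; apply/differentiable_continuous/derivable1_diffP.
by have [] := is_derive_stein_sol x.
Qed.

Lemma measurable_stein_sol : measurable_fun setT stein_sol.
Proof. exact: continuous_measurable_fun. Qed.

Lemma measurable_stein_der : measurable_fun setT stein_der.
Proof.
apply: measurable_funD; first exact: measurable_funB.
by apply: measurable_funM => //; exact: measurable_stein_sol.
Qed.

Lemma stein_sol_taylor (x y : R) :
  (`|stein_sol y - stein_sol x - (y - x) * stein_der x| <= 2 * (y - x) ^+ 2)%R.
Proof.
have [c [cx E]] : exists c, (`|c - x| <= `|y - x|)%R /\
    (stein_sol y - stein_sol x = stein_der c * (y - x))%R.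
  have cs a b : {within `[a, b], continuous stein_sol}.
    exact: continuous_subspaceT.
  have [xy|/ltW yx] := leP x y.
    have [c] := MVT_segment xy (fun z _ => is_derive_stein_sol z) (cs x y).
    rewrite in_itv/= => /andP[xc cy] E; exists c; split => //.
    by rewrite !ger0_norm ?subr_ge0// lerB.
  have [c] := MVT_segment yx (fun z _ => is_derive_stein_sol z) (cs y x).
  rewrite in_itv/= => /andP[yc cx] E; exists c; split.
    by rewrite !ler0_norm ?subr_le0// lerN2 lerB.
  by rewrite -[LHS]opprB E -mulrN opprB.
rewrite E mulrC -mulrBr normrM -[(_ ^+ 2)%R]real_normK ?num_real// expr2 mulrCA.
rewrite ler_wpM2l//; apply: le_trans (stein_der_lip _ _) _.
by rewrite ler_wpM2l.
Qed.

(** Change of density, for the normal law and Lebesgue measure. *)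
Lemma gauss_meanE : (normal_prob 0 1 : probability _ R).-integrable setT (EFin \o h) /\
  \int[normal_prob 0 1]_t (h t)%:E = m%:E.
Proof.
have [|||||] := @integral_weight_eq R _ _ _ _ mu (normal_prob 0 1 : probability _ R) id
   phi (fun=> 1%R) h _ (measurable_normal_pdf _ _) _ _ _ _ mh integrable_lipschitz_gauss => //.
- by move=> t; exact: normal_pdf_ge0.
- by move=> A mA; rewrite preimage_id integral_cst//= mul1e.
rewrite /=; under [X in _.-integrable _ X]eq_fun do rewrite mulr1.
move=> I E; split => //.
rewrite /m /gauss_mean /Rintegral fineK; last exact: integrable_fin_num integrable_lipschitz_gauss.
by rewrite E; under [RHS]eq_integral do rewrite mulr1.
Qed.

End stein_equation.

(** * Stein's method for the normalized sum *)

Section measurability.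
Context {R : realType} {d : measure_display} {T : measurableType d}.

Lemma measurable_sqrt : measurable_fun setT (Num.sqrt : R -> R).
Proof. by apply: continuous_measurable_fun; exact: sqrt_continuous. Qed.

Lemma measurable_inv_sqrt (f : T -> R) : measurable_fun setT f ->
  measurable_fun setT (fun w => (Num.sqrt (f w))^-1)%R.
Proof.
move=> mf; under eq_fun do rewrite -powR_inv1 ?sqrtr_ge0//.
apply: (measurableT_comp (measurable_powR (-1)%R)).
by apply: measurableT_comp mf; exact: measurable_sqrt.
Qed.

End measurability.

Section elementary.
Context {R : realType}.
Local Open Scope ring_scope.

Lemma ler_cube (a : R) : 0 <= a -> a <= 1 + a ^+ 3.
Proof.
move=> a0; have [a1|/ltW a1] := leP a 1.
  by rewrite (@le_trans _ _ 1)// lerDl exprn_ge0.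
by rewrite (@le_trans _ _ (a ^+ 3))// ?lerDr// ler_eXnr.
Qed.

Lemma sqr_ler_cube (a : R) : 0 <= a -> a ^+ 2 <= 1 + a ^+ 3.
Proof.
move=> a0; have [a1|/ltW a1] := leP a 1.
  by rewrite (@le_trans _ _ 1)// ?expr_le1// lerDl exprn_ge0.
by rewrite (@le_trans _ _ (a ^+ 3))// ?lerDr// ler_weXn2l.
Qed.

Lemma sqr_mul_ler_cubes (a b : R) : 0 <= a -> 0 <= b -> a ^+ 2 * b <= a ^+ 3 + b ^+ 3.
Proof.
move=> a0 b0; have [ab|/ltW ba] := leP a b.
  rewrite (@le_trans _ _ (b ^+ 3))// ?lerDr ?exprn_ge0//.
  by rewrite [leRHS]exprSr ler_wpM2r// lerXn2r// nnegrE.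
rewrite (@le_trans _ _ (a ^+ 3))// ?lerDl ?exprn_ge0//.
by rewrite [leRHS]exprSr ler_wpM2l// exprn_ge0.
Qed.

(** A pointwise substitute for E[a^2] E[a] <= E[a^3]: when u^2 is the conditional
    mean of a^2, the subtracted term has mean zero. *)
Lemma cube_tangent (a u : R) : 0 <= a -> 0 <= u ->
  u ^+ 2 * a <= a ^+ 3 - u * (a ^+ 2 - u ^+ 2).
Proof.
move=> a0 u0; rewrite -subr_ge0.
have -> : a ^+ 3 - u * (a ^+ 2 - u ^+ 2) - u ^+ 2 * a = (a - u) ^+ 2 * (a + u) by ring.
by rewrite mulr_ge0 ?sqr_ge0// addr_ge0.
Qed.

End elementary.

Section stein_sum.
Context {R : realType} {d : measure_display} {T : measurableType d}.
Variables (P : probability T R) (H : set_system T) (G : nat -> set_system T).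
Hypotheses (sH : sigma_subalgebra H) (sG : forall j, sigma_subalgebra (G j)).
Hypothesis HG : forall j, H `<=` G j.
Variable X : nat -> T -> R.
Hypothesis mX : forall j, measurable_fun setT (X j).
Hypothesis lawX : forall j, same_cond_law P (G j) H (X j).
Hypothesis XG : forall i j, i != j -> measurable_wrt (G j) (X i).
Variables M V : nat -> T -> R.
Hypothesis condM : forall j, is_cond_exp P H (X j) (M j).
Hypothesis condV : forall j, is_cond_var P H (X j) (V j).
Variable n : nat.
Hypothesis s_gt0 : {ae P, forall w, (0 < cond_std V n w)%R}.

(* Notation of the introductory comment: r = 1 / s, Wm i = W - xi i. The
   truncations in Vp and u are inactive almost surely; they make v a
   nonnegative weight and u a bounded function everywhere. *)
Let r w := (cond_std V n w)^-1%R.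

Let xi j w := (r w * (X j w - M j w))%R.

Let Vp j w := Num.max (V j w) 0%R.

Let v j w := (r w ^+ 2 * Vp j w)%R.

Let u j w : R := Num.min (Num.sqrt (v j w)) 1%R.

Let W w := (\sum_(j < n) xi j w)%R.

Let Wm (i : nat) w : R := (\sum_(j < n | j != i :> nat) xi j w)%R.

Let K w : R := (\sum_(j < n) `|xi j w| ^+ 3)%R.

Hypothesis IK : P.-integrable setT (EFin \o K).

Variable h : R -> R.
Hypothesis hL : forall s t, (`|h s - h t| <= `|s - t|)%R.

Let f := stein_sol h.
Let f' := stein_der h.

Let r_ge0 w : (0 <= r w)%R. Proof. by rewrite invr_ge0 sqrtr_ge0. Qed.

Let HM j : measurable_wrt H (M j). Proof. by case: (condM j). Qed.

Let HV j : measurable_wrt H (V j). Proof. by case: (condV j) => ? _ []. Qed.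

Let wrt_sub j (g : T -> R) : measurable_wrt H g -> measurable_wrt (G j) g.
Proof. by move=> mg B mB; exact/HG/mg. Qed.

Let Hr : measurable_wrt H r.
Proof.
apply/(measurable_wrtP sH); apply: measurable_inv_sqrt.
by apply: measurable_sum => j; exact/(measurable_wrtP sH).
Qed.

Let Hv j : measurable_wrt H (v j).
Proof.
apply/(measurable_wrtP sH)/measurable_funM.
  by apply: measurable_funX; exact/(measurable_wrtP sH).
by apply: measurable_maxr => //; exact/(measurable_wrtP sH).
Qed.

Let Hu j : measurable_wrt H (u j).
Proof.
apply/(measurable_wrtP sH)/measurable_minr => //.
apply: measurableT_comp; first exact: measurable_sqrt.
exact/(measurable_wrtP sH).
Qed.

Let Gxi i j : i != j -> measurable_wrt (G j) (xi i).
Proof.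
move=> ij; apply/(measurable_wrtP (sG j))/measurable_funM.
  exact/(measurable_wrtP (sG j))/wrt_sub.
apply: measurable_funB; apply/(measurable_wrtP (sG j)); first exact: XG.
exact: wrt_sub.
Qed.

Let GWm i : measurable_wrt (G i) (Wm i).
Proof.
apply/(measurable_wrtP (sG i)).
have -> : Wm i = (fun w => \sum_(j < n) if j != i :> nat then xi j w else 0)%R.
  by apply/funext => w; rewrite /Wm big_mkcond.
apply: measurable_sum => j; have [//|ji] := eqVneq (j : nat) i.
exact/(measurable_wrtP (sG i))/Gxi.
Qed.

Let mr : measurable_fun setT r. Proof. exact: measurable_wrt_measurable Hr. Qed.

Let mxi j : measurable_fun setT (xi j).
Proof.
apply: measurable_funM => //; apply: measurable_funB => //.
exact: (measurable_wrt_measurable sH).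
Qed.

Let mv j : measurable_fun setT (v j). Proof. exact: measurable_wrt_measurable (Hv j). Qed.

Let mu_ j : measurable_fun setT (u j). Proof. exact: measurable_wrt_measurable (Hu j). Qed.

Let mWm j : measurable_fun setT (Wm j).
Proof. exact: measurable_wrt_measurable (GWm j). Qed.

Let mf : measurable_fun setT f. Proof. exact: measurable_stein_sol. Qed.

Let mf' : measurable_fun setT f'. Proof. exact: measurable_stein_der. Qed.

Let K_ge i : (i < n)%N -> forall w, (`|xi i w| ^+ 3 <= K w)%R.
Proof.
move=> ni w; rewrite /K (bigD1 (Ordinal ni))//= lerDl.
by apply: sumr_ge0 => j _; rewrite exprn_ge0.
Qed.

Let K_ge0 w : (0 <= K w)%R.
Proof. by apply: sumr_ge0 => j _; rewrite exprn_ge0. Qed.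

Let integrable_K (c : R) (g : T -> R) : measurable_fun setT g ->
  (forall w, `|g w| <= c * (1 + K w))%R -> P.-integrable setT (EFin \o g).
Proof.
move=> mg gK.
have I : P.-integrable setT (fun w => c%:E * (1%:E + (K w)%:E)).
  apply: integrableZl => //; apply: integrableD => //.
  exact: finite_measure_integrable_cst.
apply: le_integrable I => //; first exact/measurable_EFinP.
move=> w _; rewrite -EFinD -EFinM /= lee_fin.
exact: le_trans (gK w) (ler_norm _).
Qed.

Let xi_le i : (i < n)%N -> forall w, (`|xi i w| <= 1 + K w)%R.
Proof.
move=> ni w; apply: le_trans (ler_cube (normr_ge0 _)) _.
by rewrite lerD2l K_ge.
Qed.

Let xi2_le i : (i < n)%N -> forall w, (xi i w ^+ 2 <= 1 + K w)%R.
Proof.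
move=> ni w; rewrite -real_normK ?num_real//.
apply: le_trans (sqr_ler_cube (normr_ge0 _)) _.
by rewrite lerD2l K_ge.
Qed.

Let f'_le x : (`|f' x| <= `|f' 0| + 2 * `|x|)%R.
Proof.
have := stein_der_lip hL x 0%R; rewrite subr0 -/f'.
have := ler_normD (f' x - f' 0%R)%R (f' 0%R); rewrite subrK; lra.
Qed.

(** Cubic in the xi j because f' has linear growth. *)
Let xi2f'_le i : (i < n)%N -> forall w,
  (`|xi i w ^+ 2 * f' (Wm i w)| <= (`|f' 0| + 2 * (n%:R + n%:R)) * (1 + K w))%R.
Proof.
move=> ni w; rewrite normrM ger0_norm ?sqr_ge0//.
apply: le_trans (ler_wpM2l (sqr_ge0 _) (f'_le _)) _.
rewrite [leLHS]mulrDr [leRHS]mulrDl lerD//.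
  by rewrite mulrC ler_wpM2l// xi2_le.
rewrite mulrCA -mulrA ler_wpM2l//.
apply: (@le_trans _ _ (\sum_(j < n) xi i w ^+ 2 * `|xi j w|))%R.
  rewrite -mulr_sumr ler_wpM2l ?sqr_ge0// (le_trans (ler_norm_sum _ _ _))//.
  by rewrite [leLHS]big_mkcond ler_sum// => j _; case: ifP.
have -> : ((n%:R + n%:R) * (1 + K w) = \sum_(j < n) ((1 + K w) + (1 + K w)))%R.
  by rewrite sumr_const card_ord -mulr_natl; ring.
apply: ler_sum => j _; rewrite -real_normK ?num_real//.
apply: le_trans (sqr_mul_ler_cubes (normr_ge0 _) (normr_ge0 _)) _.
by rewrite lerD// (le_trans (K_ge _ _))// lerDr.
Qed.

Let u_ge0 j w : (0 <= u j w)%R.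
Proof. by rewrite le_min sqrtr_ge0 ler01. Qed.

Let u_le1 j w : (u j w <= 1)%R.
Proof. by rewrite ge_min lexx orbT. Qed.

Let mean_sol i : (i < n)%N ->
  P.-integrable setT (fun w => (xi i w * f (Wm i w))%:E) /\
  \int[P]_w (xi i w * f (Wm i w))%:E = 0.
Proof.
move=> ni; have E : (fun w => (xi i w * f (Wm i w))%:E) =
    (fun w => ((r w * f (Wm i w)) * (X i w - M i w))%:E).
  by apply/funext => w; rewrite /xi; congr EFin; ring.
have I : P.-integrable setT (fun w => (xi i w * f (Wm i w))%:E).
  apply: (@integrable_K (1 + `|f 0|)%R).
    by apply: measurable_funM => //; exact: measurableT_comp.
  move=> w; rewrite normrM mulrC ler_pM//; first exact: stein_sol_bounded.
  exact: xi_le.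
split=> //; move: I; rewrite E => I.
apply: (cond_exp_orthogonal sH (sG i) (HG i) (lawX i) (mX i) (condM i)) => //.
apply/(measurable_wrtP (sG i))/measurable_funM.
  exact/(measurable_wrtP (sG i))/wrt_sub.
by apply: measurableT_comp => //; exact/(measurable_wrtP (sG i)).
Qed.

Let mean_test i (g : T -> R) : (i < n)%N -> measurable_wrt (G i) g ->
  P.-integrable setT (fun w => (xi i w ^+ 2 * g w)%:E) ->
  P.-integrable setT (fun w => ((xi i w ^+ 2 - v i w) * g w)%:E) /\
  \int[P]_w ((xi i w ^+ 2 - v i w) * g w)%:E = 0.
Proof.
move=> ni Gg I.
have E : (fun w => (xi i w ^+ 2 * g w)%:E) =
    (fun w => ((r w ^+ 2 * g w) * (X i w - M i w) ^+ 2)%:E).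
  by apply/funext => w; rewrite /xi; congr EFin; ring.
have Gg2 : measurable_wrt (G i) (fun w => r w ^+ 2 * g w)%R.
  apply/(measurable_wrtP (sG i))/measurable_funM; last exact/(measurable_wrtP (sG i)).
  by apply: measurable_funX; exact/(measurable_wrtP (sG i))/wrt_sub.
have I' := I; rewrite E in I'.
have [Iv Z] := cond_var_orthogonal sH (sG i) (HG i) (lawX i) (mX i) (condM i) (condV i) Gg2 I'.
have E2 : (fun w => ((xi i w ^+ 2 - v i w) * g w)%:E) =
  (fun w => ((r w ^+ 2 * g w) * ((X i w - M i w) ^+ 2 - Num.max (V i w) 0))%:E).
  by apply/funext => w; rewrite /xi /v /Vp; congr EFin; ring.
split; last by rewrite E2.
rewrite E2; under eq_fun do rewrite mulrBr EFinB.
exact: integrableB.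
Qed.

Let D i w : R := ((xi i w ^+ 2 - v i w) * f' (Wm i w) + xi i w * f (Wm i w))%R.

Let Q i w : R := ((xi i w ^+ 2 - v i w) * u i w)%R.

Let mean_D i : (i < n)%N ->
  P.-integrable setT (EFin \o D i) /\ \int[P]_w (D i w)%:E = 0.
Proof.
move=> ni; have [I1 E1] := mean_sol ni.
have [I2 E2] : P.-integrable setT (fun w => ((xi i w ^+ 2 - v i w) * f' (Wm i w))%:E) /\
    \int[P]_w ((xi i w ^+ 2 - v i w) * f' (Wm i w))%:E = 0.
  apply: mean_test => //.
    apply/(measurable_wrtP (sG i)); apply: measurableT_comp => //.
    exact/(measurable_wrtP (sG i)).
  apply: (integrable_K _ (xi2f'_le ni)).
  by apply: measurable_funM; [exact: measurable_funX|exact: measurableT_comp].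
split; first exact: (integrableD measurableT I2 I1).
rewrite /D; under eq_integral do rewrite EFinD.
by rewrite integralD// E1 E2 adde0.
Qed.

Let mean_Q i : (i < n)%N ->
  P.-integrable setT (EFin \o Q i) /\ \int[P]_w (Q i w)%:E = 0.
Proof.
move=> ni; apply: mean_test => //; first exact: wrt_sub.
apply: (@integrable_K 1%R).
  by apply: measurable_funM => //; exact: measurable_funX.
move=> w; rewrite mul1r ger0_norm; last by apply: mulr_ge0 => //; exact: sqr_ge0.
by rewrite (le_trans _ (xi2_le ni w))// ler_piMr ?sqr_ge0.
Qed.

(** Leave-one-out expansion of Stein's equation at W: [D i] and [Q i] collect
    the terms of mean zero. *)
Let stein_pointwise w : (0 < cond_std V n w)%R ->
  (forall i, (i < n)%N -> 0 <= V i w)%R ->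
  (`|h (W w) - gauss_mean h + \sum_(i < n) D i w| <=
   4 * K w - 2 * \sum_(i < n) Q i w)%R.
Proof.
move=> s0 V0.
have V0s : (0 <= \sum_(i < n) V i w)%R by apply: sumr_ge0 => i _; exact: V0.
have v_ge0 i : (0 <= v i w)%R by rewrite mulr_ge0 ?sqr_ge0// le_max lexx orbT.
have v1 : (\sum_(i < n) v i w = 1)%R.
  rewrite -mulr_sumr (eq_bigr (fun i : 'I_n => V i w)); last first.
    by move=> i _; rewrite /Vp max_l// V0.
  have -> : (\sum_(i < n) V i w = cond_std V n w ^+ 2)%R by rewrite sqr_sqrtr.
  by rewrite /r exprVn mulVf// expf_neq0// gt_eqF.
have v_le1 i : (i < n)%N -> (v i w <= 1)%R.
  move=> ni; rewrite -v1 (bigD1 (Ordinal ni))//= lerDl.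
  by apply: sumr_ge0.
have u2 i : (i < n)%N -> (u i w ^+ 2 = v i w)%R.
  move=> ni; rewrite /u min_l ?sqr_sqrtr//.
  by rewrite -sqrtr1 ler_wsqrtr// v_le1.
have WE i : (i < n)%N -> (W w = xi i w + Wm i w)%R.
  by move=> ni; rewrite /W (bigD1 (Ordinal ni)).
have hE : (h (W w) - gauss_mean h = \sum_(i < n) (v i w * f' (W w) - xi i w * f (W w)))%R.
  by rewrite -(stein_eq h) sumrB -!mulr_suml v1 mul1r.
rewrite hE -big_split /= mulr_sumr mulr_sumr -sumrB.
apply: le_trans (ler_norm_sum _ _ _) _; apply: ler_sum => i _.
have ni := ltn_ord i.
have -> : (v i w * f' (W w) - xi i w * f (W w) + D i w =
    v i w * (f' (W w) - f' (Wm i w)) -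
    xi i w * (f (W w) - f (Wm i w) - (W w - Wm i w) * f' (Wm i w)))%R.
  rewrite /D (WE _ ni) addrK; ring.
have dW : (W w - Wm i w = xi i w)%R by rewrite (WE _ ni) addrK.
have b1 : (`|v i w * (f' (W w) - f' (Wm i w))| <= 2 * (v i w * `|xi i w|))%R.
  rewrite normrM (ger0_norm (v_ge0 _)) mulrCA ler_wpM2l//.
  by have := stein_der_lip hL (W w) (Wm i w); rewrite dW.
have b2 : (`|xi i w * (f (W w) - f (Wm i w) - (W w - Wm i w) * f' (Wm i w))| <=
    2 * `|xi i w| ^+ 3)%R.
  rewrite normrM [X in (_ <= 2 * X)%R]exprS mulrCA ler_wpM2l//.
  have := stein_sol_taylor hL (Wm i w) (W w).
  by rewrite dW -[in X in (_ <= X)%R -> _]real_normK ?num_real.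
have b3 : (v i w * `|xi i w| <= `|xi i w| ^+ 3 - Q i w)%R.
  have := cube_tangent (normr_ge0 (xi i w)) (u_ge0 i w).
  by rewrite u2// real_normK ?num_real// /Q mulrC [(u i w * _)%R]mulrC [(`|_| * _)%R]mulrC.
apply: le_trans (ler_normB _ _) _; lra.
Qed.

Lemma stein_bound :
  P.-integrable setT (EFin \o (h \o W)) /\
  `|\int[P]_w (h (W w))%:E - (gauss_mean h)%:E| <= 4%:E * \int[P]_w (K w)%:E.
Proof.
have mW : measurable_fun setT W by apply: measurable_sum.
have mh : measurable_fun setT h by exact: measurable_lipschitz hL.
have Ih : P.-integrable setT (EFin \o (h \o W)).
  apply: (@integrable_K (`|h 0| + n%:R)%R); first exact: measurableT_comp.
  move=> w; have := hL (W w) 0%R; rewrite subr0 /=.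
  have := ler_normD (h (W w) - h 0)%R (h 0%R); rewrite subrK.
  have W_le : (`|W w| <= n%:R * (1 + K w))%R.
    rewrite (le_trans (ler_norm_sum _ _ _))//.
    rewrite mulr_natl -[X in (_ *+ X)%R]card_ord -sumr_const.
    by apply: ler_sum => j _; exact: xi_le.
  have : (0 <= `|h 0| * K w)%R by rewrite mulr_ge0.
  rewrite mulrDl mulrDr mulr1; lra.
split => //.
pose sD w := (\sum_(i < n) D i w)%R.
pose sQ w := (\sum_(i < n) Q i w)%R.
have mean_sum (B : nat -> T -> R) : (forall i, (i < n)%N ->
      P.-integrable setT (EFin \o B i) /\ \int[P]_w (B i w)%:E = 0) ->
    P.-integrable setT (fun w => (\sum_(i < n) B i w)%:E) /\
    \int[P]_w (\sum_(i < n) B i w)%:E = 0.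
  move=> HB.
  have E : (fun w => (\sum_(i < n) B i w)%:E) = (fun w => \sum_(i < n) (B i w)%:E).
    by apply/funext => w; rewrite sumEFin.
  rewrite E; split.
    by apply: integrable_sum => // i _; exact: (HB i (ltn_ord i)).1.
  rewrite integral_sum//; first by apply: big1 => i _; exact: (HB i (ltn_ord i)).2.
  by move=> i; exact: (HB i (ltn_ord i)).1.
have [IsD EsD] := mean_sum _ mean_D.
have [IsQ EsQ] := mean_sum _ mean_Q.
pose A w : R := (h (W w) - gauss_mean h + sD w)%R.
pose B w : R := (4 * K w - 2 * sQ w)%R.
have Ic : P.-integrable setT (fun=> (gauss_mean h)%:E).
  exact: finite_measure_integrable_cst.
have IhB : P.-integrable setT (fun w => (h (W w) - gauss_mean h)%:E).
  exact: (integrableB measurableT Ih Ic).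
have IA : P.-integrable setT (EFin \o A) := integrableD measurableT IhB IsD.
have I4 : P.-integrable setT (fun w => (4 * K w)%:E).
  exact: (integrableZl measurableT 4%R IK).
have I2 : P.-integrable setT (fun w => (2 * sQ w)%:E).
  exact: (integrableZl measurableT 2%R IsQ).
have IB : P.-integrable setT (EFin \o B) := integrableB measurableT I4 I2.
have EA : \int[P]_w (A w)%:E = \int[P]_w (h (W w))%:E - (gauss_mean h)%:E.
  rewrite /A; under eq_integral do rewrite EFinD.
  rewrite integralD// EsD adde0; under eq_integral do rewrite EFinB.
  rewrite integralB//; congr (_ - _).
  by rewrite integral_cst// [X in (_ * X)]probability_setT mule1.
have EB : \int[P]_w (B w)%:E = 4%:E * \int[P]_w (K w)%:E.
  rewrite /B; under eq_integral do rewrite EFinB.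
  rewrite integralB//.
  under eq_integral do rewrite EFinM.
  under [X in _ - X]eq_integral do rewrite EFinM.
  by rewrite !integralZl// EsQ mule0 sube0.
have AB : {ae P, forall w, (`|A w| <= B w)%R}.
  have V0 : {ae P, forall w, forall i, (i < n)%N -> (0 <= V i w)%R}.
    have V0 i : {ae P, forall w, (0 <= V i w)%R}.
      have [M' _ cV] := condV i.
      by apply: (cond_exp_ge0 sH _ cV) => w; exact: sqr_ge0.
    by apply: filterS (ae_foralln V0) => w + i _; apply.
  move: s_gt0 V0; apply: filterS2 => w s0 V0.
  exact: stein_pointwise.
rewrite -EA -EB.
have fA : \int[P]_w (A w)%:E \is a fin_num by exact: integrable_fin_num.
have fB : \int[P]_w (B w)%:E \is a fin_num by exact: integrable_fin_num.
have le (C : T -> R) : P.-integrable setT (EFin \o C) ->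
    {ae P, forall w, (C w <= B w)%R} -> \int[P]_w (C w)%:E <= \int[P]_w (B w)%:E.
  move=> IC CB; rewrite -sube_ge0; last by rewrite integrable_fin_num// orbT.
  rewrite -integralB//; apply: ae_ge0_integral; first exact: (integrableB measurableT IB IC).
  by apply: filterS CB => w; rewrite subr_ge0.
rewrite -(fineK fA) /= -(fineK fB) lee_fin ler_norml; apply/andP; split.
  rewrite lerNl -lee_fin EFinN !fineK// -integralN; last exact: integrable_add_def.
  apply: (le (fun w => - A w)%R); first exact: integrableN IA.
  by apply: filterS AB => w; apply: le_trans; rewrite -normrN ler_norm.
rewrite -lee_fin !fineK//; apply: le => //.
by apply: filterS AB => w; apply: le_trans; rewrite ler_norm.
Qed.

End stein_sum.

(** * The sigma-algebras generated by the latent variable and by the sample *)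

Section latent.
Context {R : realType} {d : measure_display} {T : measurableType d}.
Context {E : topologicalType} (Z : T -> E) (X : nat -> T -> R).
Hypothesis mZ : forall B : set E, borel B -> measurable (Z @^-1` B).
Hypothesis mX : forall j, measurable_fun setT (X j).

Definition latent : set_system T := sigma_of (@borel E) Z.

Definition others (j : nat) : set_system T :=
  <<s (\bigcup_(i in [set i | i <> j]) sigma_of measurable (X i)) `|` latent >>.

Lemma latent_sigma_subalgebra : sigma_subalgebra latent.
Proof.
split; first by apply: sigma_algebra_preimage; exact: smallest_sigma_algebra.
by move=> _ [B bB <-]; rewrite setTI; exact: mZ.
Qed.

Lemma others_sigma_subalgebra j : sigma_subalgebra (others j).
Proof.
split; first exact: smallest_sigma_algebra.
apply: smallest_sub; first exact: sigma_algebra_measurable.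
move=> A [[i _ [B mB <-]]|/latent_sigma_subalgebra.2//].
exact: mX.
Qed.

Lemma latent_others j : latent `<=` others j.
Proof. by move=> A lA; apply: sub_sigma_algebra; right. Qed.

Lemma measurable_wrt_others i j : i != j -> measurable_wrt (others j) (X i).
Proof.
move=> /eqP ij B mB; apply: sub_sigma_algebra; left.
by exists i => //; exists B => //; rewrite setTI.
Qed.

End latent.

Theorem corollary4p3 (R : realType) (d : measure_display)
    (T : measurableType d) (P : probability T R)
    (E : topologicalType) (polishE : polish_space R E)
    (Z : T -> E)
    (mZ : forall B : set E, borel B -> measurable (Z @^-1` B))
    (X : nat -> {RV P >-> R})
    (X3 : forall j : nat, 'E_P[fun w => (`|X j w| ^+ 3)%R] < +oo)
    (indepX : cond_independent P Z (fun j w => X j w))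
    (* versions of E[X_j | Z] and var(X_j | Z) *)
    (M V : nat -> T -> R)
    (condM : forall j : nat, is_cond_exp P (sigma_of (@borel E) Z) (X j) (M j))
    (condV : forall j : nat, is_cond_var P (sigma_of (@borel E) Z) (X j) (V j))
    (n : nat) (n_ge1 : (1 <= n)%N)
    (s_gt0 : {ae P, forall w, (0 < cond_std V n w)%R}) :
  wasserstein P (normalized_sum (fun j w => X j w) M V n) (normal_prob 0 1)
  <= (2 * (Num.sqrt 2 + 1))%:E *
     'E_P[fun w => ((cond_std V n w ^+ 3)^-1 *
                    \sum_(i < n) `|X i w - M i w| ^+ 3)%R].
Proof.
have mX j : measurable_fun setT (fun w => X j w) by exact: measurable_funP.
have sH := latent_sigma_subalgebra mZ.
have sG := others_sigma_subalgebra mZ mX.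
pose K w : R := (\sum_(i < n) `|(cond_std V n w)^-1 * (X i w - M i w)| ^+ 3)%R.
have KE : (fun w => ((cond_std V n w ^+ 3)^-1 *
    \sum_(i < n) `|X i w - M i w| ^+ 3)%R) = K.
  apply/funext => w; rewrite mulr_sumr; apply: eq_bigr => i _.
  by rewrite normrM exprMn ger0_norm ?invr_ge0 ?sqrtr_ge0// exprVn.
rewrite KE {KE}.
have mK : measurable_fun setT K.
  apply: measurable_sum => i; apply: measurable_funX.
  apply: measurableT_comp => //; apply: measurable_funM.
    apply: measurable_inv_sqrt; apply: measurable_sum => j.
    by have [M' _ [_ /measurable_int/measurable_EFinP]] := condV j.
  apply: measurable_funB => //.
  by have [_ /measurable_int/measurable_EFinP] := condM i.
have K0 w : (0 <= K w)%R by apply: sumr_ge0 => i _; rewrite exprn_ge0.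
have c0 : (0 < 2 * (Num.sqrt 2 + 1) :> R)%R.
  by rewrite mulr_gt0// ltr_wpDl// sqrtr_ge0.
have EK0 : 0 <= 'E_P[K] by exact: expectation_ge0.
have [->|Koo] := eqVneq ('E_P[K]) +oo.
  by rewrite gt0_muley ?leey// lte_fin.
have IK : P.-integrable setT (EFin \o K).
  apply/integrableP; split; first exact/measurable_EFinP.
  under eq_integral do rewrite /= ger0_norm//.
  by move: Koo; rewrite unlock -ltey.
apply: ge_ereal_sup => _ [h hlip <-].
have hL s t : (`|h s - h t| <= `|s - t|)%R.
  by have /= := hlip (s, t) (conj Logic.I Logic.I); rewrite mul1r.
have [Ih le4] := stein_bound sH sG (@latent_others _ _ _ _ Z (fun j w => X j w)) mX indepX
  (@measurable_wrt_others _ _ _ _ Z (fun j w => X j w)) condM condV s_gt0 IK hL.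
have [_ mean] := gauss_meanE hL.
have -> : 'E_P[h \o normalized_sum (fun j w => X j w) M V n] =
    \int[P]_w (h (\sum_(j < n) (cond_std V n w)^-1 * (X j w - M j w))%R)%:E.
  by rewrite unlock; apply: eq_integral => w _; rewrite /= /normalized_sum mulr_sumr.
have -> : 'E_(normal_prob 0 1)[h] = (gauss_mean h)%:E by rewrite unlock.
have -> : 'E_P[K] = \int[P]_w (K w)%:E by rewrite unlock.
apply: le_trans le4 _; apply: lee_wpmul2r.
  by apply: integral_ge0 => w _; rewrite lee_fin; exact: K0.
rewrite lee_fin.
have : (1 <= Num.sqrt 2 :> R)%R by rewrite -[leLHS]sqrtr1 ler_wsqrtr// ler1n.
lra.
Qed.
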